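(* Let $\mathbb{P}_\nearrow^!$ be the Koszul dual of the quadratic operad $\mathbb{P}_\nearrow$. Then $\mathbb{P}_\nearrow^!$ is generated, as an operad, by two elements $m,\nearrow\,\in \mathbb{P}_\nearrow^!(2)$ with the relations $$\left\{\begin{array}{rcl} \nearrow\circ(\nearrow,I)&=&\nearrow\circ(I,\nearrow),\\ m\circ(m,I)&=&m\circ(I,m),\\ m\circ(\nearrow,I)&=&\nearrow\circ(I,m),\\ \nearrow\circ(m,I)&=&0,\\ m\circ(I,\nearrow)&=&0. \end{array}\right.$$
   Context: Operads are symmetric operads in vector spaces over a field $K$. $I$ denotes the unit of the operad, and for binary operations $a,b$: $a\circ(b,I)$ is the operation $(x,y,z)\mapsto a(b(x,y),z)$, and $a\circ(I,b)$ is $(x,y,z)\mapsto a(x,b(y,z))$. ''Generated by $m$ and $\nearrow$ with relations ...'' means: the quotient of the operad $\mathbb{P}(E)$ freely generated by $E$, the free $S_2$-module (placed in arity 2) with basis $\{m,\nearrow\}$, by the operadic ideal generated by the relations (no symmetry is imposed on $m$ and $\nearrow$). The operad $\mathbb{P}_\nearrow$ is generated by $m$ and $\nearrow$ (in arity 2) with the relations $$\nearrow\circ(\nearrow,I)=\nearrow\circ(I,\nearrow),\qquad \nearrow\circ(I,m)=m\circ(\nearrow,I),\qquad m\circ(m,I)=m\circ(I,m).$$ For a quadratic operad $\mathbb{P}(E)/(R)$, with $R$ a sub-$S_3$-module of $\mathbb{P}(E)(3)$, its Koszul dual (Ginzburg–Kapranov) is the quadratic operad $\mathbb{P}(E^\vee)/(R^\perp)$,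 where $E^\vee=E^*\otimes \mathrm{sgn}$ and $R^\perp\subseteq \mathbb{P}(E^\vee)(3)\cong \mathbb{P}(E)(3)^*\otimes\mathrm{sgn}$ is the annihilator of $R$. *)

(* Defs.v *)
From HB Require Import structures.
From mathcomp Require Import all_boot all_order all_algebra all_fingroup.
From mathcomp Require Import generic_quotient boolp.

Set Implicit Arguments.
Unset Strict Implicit.
Unset Printing Implicit Defensive.

Import GRing.Theory.
Local Open Scope ring_scope.
Local Open Scope quotient_scope.

(* Conventions for symmetric operads.
   - Inputs are numbered from 0, and [op_comp e i a b] is the partial
     composition "a o_i b": the n inputs of b replace the input i of a.  The
     arity p of the result satisfies m + n = p.+1, and the proof e of this
     equation is an argument, so that the axioms need no casts.
   - [op_act s a] is the operation (x_0, .., x_(n-1)) |->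
     a (x_(s 0), .., x_(s (n-1))): the input j of a becomes the input s j.
     Since (s * t) j = t (s j) in MathComp, this is a right action. *)

(* In a o_i b, with b of arity n, the position of the input j != i of a; the
   input j of b is in position i + j. *)
Definition outer_pos (n i j : nat) : nat := if (j < i)%N then j else (j + n).-1.

(* r is the block permutation relating a o_i b and (a.s) o_(s i) (b.t);
   exactly one r satisfies this when m + n = p.+1. *)
Definition block_perm m n p (i : 'I_m) (s : 'S_m) (t : 'S_n) (r : 'S_p) :=
  (forall (j : 'I_m) (x : 'I_p), j != i ->
     x = outer_pos n i j :> nat -> r x = outer_pos n (s i) (s j) :> nat) /\
  (forall (j : 'I_n) (x : 'I_p),
     x = (i + j)%N :> nat -> r x = (s i + t j)%N :> nat).

Record operad (K : fieldType) := Operad {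
  op_mod :> nat -> lmodType K;
  op_act : forall n, 'S_n -> op_mod n -> op_mod n;
  op_one : op_mod 1;
  op_comp : forall m n p, (m + n = p.+1)%N -> 'I_m ->
    op_mod m -> op_mod n -> op_mod p;
  op_act_lin : forall n (s : 'S_n), linear (@op_act n s);
  op_act1 : forall n (a : op_mod n), op_act 1%g a = a;
  op_actM : forall n (s t : 'S_n) (a : op_mod n),
    op_act (s * t)%g a = op_act t (op_act s a);
  op_comp_linl : forall m n p (e : (m + n = p.+1)%N) (i : 'I_m) (b : op_mod n),
    linear (fun a => op_comp e i a b);
  op_comp_linr : forall m n p (e : (m + n = p.+1)%N) (i : 'I_m) (a : op_mod m),
    linear (op_comp e i a);
  op_comp1l : forall n (e : (1 + n = n.+1)%N) (a : op_mod n),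
    op_comp e ord0 op_one a = a;
  op_comp1r : forall n (e : (n + 1 = n.+1)%N) (i : 'I_n) (a : op_mod n),
    op_comp e i a op_one = a;
  op_comp_seq : forall l m n p q r
      (e1 : (l + m = p.+1)%N) (e2 : (p + n = q.+1)%N)
      (e3 : (m + n = r.+1)%N) (e4 : (l + r = q.+1)%N)
      (i : 'I_l) (j : 'I_m) (k : 'I_p) (a : op_mod l) (b : op_mod m)
      (c : op_mod n), k = (i + j)%N :> nat ->
    op_comp e2 k (op_comp e1 i a b) c = op_comp e4 i a (op_comp e3 j b c);
  op_comp_par : forall l m n p q r
      (e1 : (l + m = p.+1)%N) (e2 : (p + n = q.+1)%N)
      (e3 : (l + n = r.+1)%N) (e4 : (r + m = q.+1)%N)
      (i k : 'I_l) (k' : 'I_p) (i' : 'I_r) (a : op_mod l) (b : op_mod m)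
      (c : op_mod n), (i < k)%N -> k'.+1 = (k + m)%N -> i' = i :> nat ->
    op_comp e2 k' (op_comp e1 i a b) c = op_comp e4 i' (op_comp e3 k a c) b;
  op_comp_act : forall m n p (e : (m + n = p.+1)%N) (i : 'I_m)
      (s : 'S_m) (t : 'S_n) (r : 'S_p) (a : op_mod m) (b : op_mod n),
    block_perm i s t r ->
    op_comp e (s i) (op_act s a) (op_act t b) = op_act r (op_comp e i a b)
}.

Record operad_morphism (K : fieldType) (P Q : operad K) := OperadMorphism {
  om_fun :> forall n, P n -> Q n;
  om_lin : forall n, linear (@om_fun n);
  om_act : forall n (s : 'S_n) (a : P n), om_fun (op_act s a) = op_act s (om_fun a);
  om_one : om_fun (op_one P) = op_one Q;
  om_comp : forall m n p (e : (m + n = p.+1)%N) (i : 'I_m) (a : P m) (b : P n),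
    om_fun (op_comp e i a b) = op_comp e i (om_fun a) (om_fun b)
}.

Definition operad_isomorphism (K : fieldType) (P Q : operad K)
    (f : operad_morphism P Q) : Prop :=
  forall n, bijective (@om_fun _ _ _ f n).

Record subspace (K : fieldType) (V : lmodType K) := Subspace {
  sub_pred :> V -> Prop;
  sub_pred0 : sub_pred 0;
  sub_predP : forall c x y, sub_pred x -> sub_pred y -> sub_pred (c *: x + y)
}.

Section LinearQuotient.
Variables (K : fieldType) (V : lmodType K) (I : subspace V).

Definition quot_rel : rel V := fun x y => `[< I (x - y) >].

Lemma sub_predD x y : I x -> I y -> I (x + y).
Proof. by move=> Ix Iy; rewrite -[x]scale1r; apply: sub_predP. Qed.

Lemma sub_predZ c x : I x -> I (c *: x).
Proof.
by move=> Ix; rewrite -[_ *: _]addr0; apply: sub_predP => //; apply: sub_pred0.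
Qed.

Lemma quot_rel_equiv : equiv_class_of quot_rel.
Proof.
split.
- by move=> x; apply/asboolP; rewrite subrr; apply: sub_pred0.
- move=> x y; apply/asboolP/asboolP => H.
    by rewrite -opprB -scaleN1r; apply: sub_predZ.
  by rewrite -opprB -scaleN1r; apply: sub_predZ.
- move=> y x z /asboolP H1 /asboolP H2; apply/asboolP.
  by rewrite -(subrKA y); apply: sub_predD.
Qed.

Canonical quot_equiv := EquivRelPack quot_rel_equiv.

Definition lquot := {eq_quot quot_equiv}.
HB.instance Definition _ := Choice.on lquot.

Definition lpi (x : V) : lquot := \pi_lquot x.

Lemma lpiP x y : lpi x = lpi y <-> I (x - y).
Proof. by split => [/eqmodP/asboolP | H] //; apply/eqmodP/asboolP. Qed.

Lemma lpiK (q : lquot) : lpi (repr q) = q.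
Proof. exact: reprK. Qed.

Lemma reprI x : I (repr (lpi x) - x).
Proof. by apply/lpiP; rewrite lpiK. Qed.

Definition lq_add (p q : lquot) : lquot := lpi (repr p + repr q).
Definition lq_opp (p : lquot) : lquot := lpi (- repr p).
Definition lq_scale (c : K) (p : lquot) : lquot := lpi (c *: repr p).

Lemma lq_addE x y : lq_add (lpi x) (lpi y) = lpi (x + y).
Proof. by apply/lpiP; rewrite opprD addrACA; apply: sub_predD; apply: reprI. Qed.

Lemma lq_scaleE c x : lq_scale c (lpi x) = lpi (c *: x).
Proof. by apply/lpiP; rewrite -scalerBr; apply: sub_predZ; apply: reprI. Qed.

Lemma lq_oppE x : lq_opp (lpi x) = lpi (- x).
Proof.
apply/lpiP; rewrite -opprD -[X in I X]scaleN1r; apply: sub_predZ; exact: reprI.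
Qed.

Lemma lq_ind (Q : lquot -> Prop) : (forall x, Q (lpi x)) -> forall q, Q q.
Proof. by move=> H q; rewrite -(lpiK q). Qed.

Fact lq_addA : associative lq_add.
Proof. by do 3![elim/lq_ind => ?]; rewrite !lq_addE addrA. Qed.
Fact lq_addC : commutative lq_add.
Proof. by do 2![elim/lq_ind => ?]; rewrite !lq_addE addrC. Qed.
Fact lq_add0 : left_id (lpi 0) lq_add.
Proof. by elim/lq_ind => ?; rewrite !lq_addE add0r. Qed.
Fact lq_addN : left_inverse (lpi 0) lq_opp lq_add.
Proof. by elim/lq_ind => ?; rewrite lq_oppE !lq_addE addNr. Qed.

HB.instance Definition _ :=
  GRing.isZmodule.Build lquot lq_addA lq_addC lq_add0 lq_addN.

Fact lq_scaleA a b v : lq_scale a (lq_scale b v) = lq_scale (a * b) v.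
Proof. by elim/lq_ind: v => ?; rewrite !lq_scaleE scalerA. Qed.
Fact lq_scale1 : left_id 1 lq_scale.
Proof. by elim/lq_ind => ?; rewrite !lq_scaleE scale1r. Qed.
Fact lq_scaleDr : right_distributive lq_scale +%R.
Proof.
move=> c; do 2![elim/lq_ind => ?].
by rewrite [X in lq_scale _ X]lq_addE !lq_scaleE [RHS]lq_addE scalerDr.
Qed.
Fact lq_scaleDl v : {morph lq_scale^~ v : a b / a + b}.
Proof.
by elim/lq_ind: v => ? a b; rewrite !lq_scaleE [RHS]lq_addE scalerDl.
Qed.

HB.instance Definition _ := GRing.Zmodule_isLmodule.Build K lquot
  lq_scaleA lq_scale1 lq_scaleDr lq_scaleDl.

Lemma lpi_linear c x y : lpi (c *: x + y) = c *: lpi x + lpi y.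
Proof. by rewrite -lq_addE -lq_scaleE. Qed.

End LinearQuotient.

Record ideal (K : fieldType) (P : operad K) := Ideal {
  id_sub :> forall n, subspace (P n);
  id_act : forall n (s : 'S_n) (x : P n), id_sub n x -> id_sub n (op_act s x);
  id_compl : forall m n p (e : (m + n = p.+1)%N) (i : 'I_m) (x : P m) (b : P n),
    id_sub m x -> id_sub p (op_comp e i x b);
  id_compr : forall m n p (e : (m + n = p.+1)%N) (i : 'I_m) (a : P m) (x : P n),
    id_sub n x -> id_sub p (op_comp e i a x)
}.

Section OperadQuotient.
Variables (K : fieldType) (P : operad K) (I : ideal P).

Let Q (n : nat) : lmodType K := lquot (I n).
Definition oq_act n (s : 'S_n) (x : Q n) : Q n := lpi (I n) (op_act s (repr x)).
Definition oq_comp m n p (e : (m + n = p.+1)%N) (i : 'I_m) (x : Q m) (y : Q n) :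
  Q p := lpi (I p) (op_comp e i (repr x) (repr y)).

Lemma lin_sub (V W : lmodType K) (f : V -> W) :
  linear f -> forall x y, f (x - y) = f x - f y.
Proof. by move=> fl x y; rewrite addrC -scaleN1r fl scaleN1r addrC. Qed.

Lemma oq_actE n s (x : P n) : oq_act s (lpi (I n) x) = lpi (I n) (op_act s x).
Proof.
apply/lpiP; rewrite -(lin_sub (op_act_lin _)); apply/id_act/reprI.
Qed.

Lemma oq_compE m n p (e : (m + n = p.+1)%N) i (x : P m) (y : P n) :
  oq_comp e i (lpi (I m) x) (lpi (I n) y) = lpi (I p) (op_comp e i x y).
Proof.
apply/lpiP; rewrite -(subrKA (op_comp e i x (repr (lpi (I n) y)))).
apply: sub_predD.
- rewrite -(lin_sub (op_comp_linl e i _)); apply/id_compl/reprI.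
- rewrite -(lin_sub (op_comp_linr e i _)); apply/id_compr/reprI.
Qed.

Let linE n c (x y : P n) : c *: lpi (I n) x + lpi (I n) y = lpi (I n) (c *: x + y).
Proof. by rewrite lpi_linear. Qed.

Definition operad_quotient : operad K.
Proof.
apply: (@Operad K Q oq_act (lpi (I 1%N) (op_one P)) oq_comp).
- move=> n s c; do 2![elim/lq_ind => ?].
  by rewrite linE !oq_actE op_act_lin linE.
- by move=> n; elim/lq_ind => a; rewrite oq_actE op_act1.
- by move=> n s t; elim/lq_ind => a; rewrite !oq_actE op_actM.
- move=> m n p e i; elim/lq_ind => b c; do 2![elim/lq_ind => ?].
  by rewrite linE !oq_compE (op_comp_linl e i b) linE.
- move=> m n p e i; elim/lq_ind => b c; do 2![elim/lq_ind => ?].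
  by rewrite linE !oq_compE (op_comp_linr e i b) linE.
- by move=> n e; elim/lq_ind => a; rewrite oq_compE op_comp1l.
- by move=> n e i; elim/lq_ind => a; rewrite oq_compE op_comp1r.
- move=> l m n p q r e1 e2 e3 e4 i j k; do 3![elim/lq_ind => ?] => H.
  by rewrite !oq_compE (op_comp_seq e1 e2 e3 e4 _ _ _ H).
- move=> l m n p q r e1 e2 e3 e4 i k k' i'; do 3![elim/lq_ind => ?] => H1 H2 H3.
  by rewrite !oq_compE (op_comp_par e1 e2 e3 e4 _ _ _ H1 H2 H3).
- move=> m n p e i s t r; do 2![elim/lq_ind => ?] => H.
  by rewrite [in RHS]oq_compE !oq_actE oq_compE (op_comp_act e _ _ H).
Defined.

Definition operad_proj n (x : P n) : operad_quotient n := lpi (I n) x.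

End OperadQuotient.

Section GeneratedIdeal.
Variables (K : fieldType) (P : operad K) (k : nat) (R : P k -> Prop).

Inductive in_ideal : forall n, P n -> Prop :=
| InIdealGen x : R x -> in_ideal x
| InIdeal0 n : in_ideal (0 : P n)
| InIdealD n c (x y : P n) : in_ideal x -> in_ideal y -> in_ideal (c *: x + y)
| InIdealAct n (s : 'S_n) (x : P n) : in_ideal x -> in_ideal (op_act s x)
| InIdealCompL m n p (e : (m + n = p.+1)%N) (i : 'I_m) (x : P m) (b : P n) :
    in_ideal x -> in_ideal (op_comp e i x b)
| InIdealCompR m n p (e : (m + n = p.+1)%N) (i : 'I_m) (a : P m) (x : P n) :
    in_ideal x -> in_ideal (op_comp e i a x).

Definition generated_ideal : ideal P :=
  @Ideal K P (fun n => Subspace (InIdeal0 n) (@InIdealD n))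
    InIdealAct InIdealCompL InIdealCompR.

Inductive in_submodule : P k -> Prop :=
| InSubGen x : R x -> in_submodule x
| InSub0 : in_submodule 0
| InSubD c x y : in_submodule x -> in_submodule y -> in_submodule (c *: x + y)
| InSubAct (s : 'S_k) x : in_submodule x -> in_submodule (op_act s x).

Definition generated_subspace : subspace (P k) := Subspace InSub0 InSubD.

End GeneratedIdeal.

(* Finite-dimensional right S_n-modules. *)
Record smodule (K : fieldType) (n : nat) := SModule {
  sm_car :> vectType K;
  sm_act : 'S_n -> sm_car -> sm_car;
  sm_act_lin : forall s, linear (sm_act s);
  sm_act1 : forall x, sm_act 1%g x = x;
  sm_actM : forall s t x, sm_act (s * t)%g x = sm_act t (sm_act s x)
}.

Section FreeSModule.
Variables (K : fieldType) (B : finType) (n : nat).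

Let V : vectType K := {ffun B * 'S_n -> K^o}.
Let act (s : 'S_n) (f : V) : V := [ffun u : B * 'S_n => f (u.1, u.2 * s^-1)%g].

Definition free_smodule : smodule K n.
Proof.
apply: (@SModule K n V act).
- by move=> s c f g; apply/ffunP => u; rewrite !ffunE.
- by move=> f; apply/ffunP => -[b s]; rewrite !ffunE invg1 mulg1.
- by move=> s t f; apply/ffunP => u; rewrite !ffunE /= invMg mulgA.
Defined.

Definition free_basis (b : B) : free_smodule :=
  [ffun u : B * 'S_n => (u == (b, 1%g))%:R].

End FreeSModule.

Section SgnDual.
Variables (K : fieldType) (n : nat) (E : smodule K n).

Let V : vectType K := 'Hom(E, K^o).

Let dual_act_fun (s : 'S_n) (f : V) (x : E) : K^o :=
  (-1) ^+ s * f (sm_act s^-1%g x).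

Fact dual_act_linear s f : linear (dual_act_fun s f).
Proof.
move=> c x y; rewrite /dual_act_fun sm_act_lin linearP mulrDr /=.
by congr (_ + _); rewrite /GRing.scale /= mulrCA.
Qed.

HB.instance Definition _ s f :=
  GRing.isLinear.Build K E K^o _ (dual_act_fun s f) (dual_act_linear s f).

Let dual_act (s : 'S_n) (f : V) : V := linfun (dual_act_fun s f).

Let dual_actE s f x : dual_act s f x = (-1) ^+ s * f (sm_act s^-1%g x).
Proof. by rewrite lfunE. Qed.

(* E^* (x) sgn, with the contragredient right action. *)
Definition sgn_dual : smodule K n.
Proof.
apply: (@SModule K n V dual_act).
- move=> s c f g; apply/lfunP => x.
  rewrite add_lfunE scale_lfunE !dual_actE add_lfunE scale_lfunE mulrDr.
  by congr (_ + _); rewrite /GRing.scale /= mulrCA.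
- move=> f; apply/lfunP => x.
  by rewrite dual_actE odd_perm1 mul1r invg1 sm_act1.
- move=> s t f; apply/lfunP => x; rewrite !dual_actE.
  by rewrite odd_permM signr_addb invMg sm_actM mulrA [X in X * _ = _]mulrC.
Defined.

End SgnDual.

(* The operad freely generated by an S_2-module E placed in arity 2: formal
   operadic expressions in the elements of E, modulo the smallest congruence
   that imposes the axioms of an operad and makes the inclusion of E linear and
   S_2-equivariant. *)
Section FreeOperad.
Variables (K : fieldType) (E : smodule K 2).

Inductive fterm : nat -> Type :=
| FGen : E -> fterm 2
| FOne : fterm 1
| FComp m n p : (m + n = p.+1)%N -> 'I_m -> fterm m -> fterm n -> fterm p
| FAct n : 'S_n -> fterm n -> fterm n
| FZero n : fterm n
| FAdd n : fterm n -> fterm n -> fterm n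
| FScale n : K -> fterm n -> fterm n.

Inductive feq : forall n, fterm n -> fterm n -> Prop :=
| feq_refl n (x : fterm n) : feq x x
| feq_sym n (x y : fterm n) : feq x y -> feq y x
| feq_trans n (y x z : fterm n) : feq x y -> feq y z -> feq x z
| feq_congComp m n p (e : (m + n = p.+1)%N) i (x x' : fterm m) (y y' : fterm n) :
    feq x x' -> feq y y' -> feq (FComp e i x y) (FComp e i x' y')
| feq_congAct n (s : 'S_n) (x x' : fterm n) :
    feq x x' -> feq (FAct s x) (FAct s x')
| feq_congAdd n (x x' y y' : fterm n) :
    feq x x' -> feq y y' -> feq (FAdd x y) (FAdd x' y')
| feq_congScale n c (x x' : fterm n) : feq x x' -> feq (FScale c x) (FScale c x')
| feq_addA n (x y z : fterm n) : feq (FAdd x (FAdd y z)) (FAdd (FAdd x y) z)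
| feq_addC n (x y : fterm n) : feq (FAdd x y) (FAdd y x)
| feq_add0 n (x : fterm n) : feq (FAdd (FZero n) x) x
| feq_addN n (x : fterm n) : feq (FAdd (FScale (-1) x) x) (FZero n)
| feq_scaleA n c d (x : fterm n) : feq (FScale c (FScale d x)) (FScale (c * d) x)
| feq_scale1 n (x : fterm n) : feq (FScale 1 x) x
| feq_scaleDr n c (x y : fterm n) :
    feq (FScale c (FAdd x y)) (FAdd (FScale c x) (FScale c y))
| feq_scaleDl n c d (x : fterm n) :
    feq (FScale (c + d) x) (FAdd (FScale c x) (FScale d x))
| feq_genLin c (u v : E) :
    feq (FGen (c *: u + v)) (FAdd (FScale c (FGen u)) (FGen v))
| feq_genAct (s : 'S_2) (u : E) : feq (FGen (sm_act s u)) (FAct s (FGen u))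
| feq_actLin n (s : 'S_n) c (x y : fterm n) :
    feq (FAct s (FAdd (FScale c x) y)) (FAdd (FScale c (FAct s x)) (FAct s y))
| feq_act1 n (x : fterm n) : feq (FAct 1%g x) x
| feq_actM n (s t : 'S_n) (x : fterm n) :
    feq (FAct (s * t)%g x) (FAct t (FAct s x))
| feq_compLinL m n p (e : (m + n = p.+1)%N) i (b : fterm n) c (x y : fterm m) :
    feq (FComp e i (FAdd (FScale c x) y) b)
        (FAdd (FScale c (FComp e i x b)) (FComp e i y b))
| feq_compLinR m n p (e : (m + n = p.+1)%N) i (a : fterm m) c (x y : fterm n) :
    feq (FComp e i a (FAdd (FScale c x) y))
        (FAdd (FScale c (FComp e i a x)) (FComp e i a y))
| feq_comp1l n (e : (1 + n = n.+1)%N) (a : fterm n) : feq (FComp e ord0 FOne a) a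
| feq_comp1r n (e : (n + 1 = n.+1)%N) (i : 'I_n) (a : fterm n) :
    feq (FComp e i a FOne) a
| feq_compSeq l m n p q r
    (e1 : (l + m = p.+1)%N) (e2 : (p + n = q.+1)%N)
    (e3 : (m + n = r.+1)%N) (e4 : (l + r = q.+1)%N)
    (i : 'I_l) (j : 'I_m) (k : 'I_p) (a : fterm l) (b : fterm m) (c : fterm n) :
    k = (i + j)%N :> nat ->
    feq (FComp e2 k (FComp e1 i a b) c) (FComp e4 i a (FComp e3 j b c))
| feq_compPar l m n p q r
    (e1 : (l + m = p.+1)%N) (e2 : (p + n = q.+1)%N)
    (e3 : (l + n = r.+1)%N) (e4 : (r + m = q.+1)%N)
    (i k : 'I_l) (k' : 'I_p) (i' : 'I_r)
    (a : fterm l) (b : fterm m) (c : fterm n) :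
    (i < k)%N -> k'.+1 = (k + m)%N -> i' = i :> nat ->
    feq (FComp e2 k' (FComp e1 i a b) c) (FComp e4 i' (FComp e3 k a c) b)
| feq_compAct m n p (e : (m + n = p.+1)%N) (i : 'I_m)
    (s : 'S_m) (t : 'S_n) (r : 'S_p) (a : fterm m) (b : fterm n) :
    block_perm i s t r ->
    feq (FComp e (s i) (FAct s a) (FAct t b)) (FAct r (FComp e i a b)).

Section Arity.
Variable n : nat.

HB.instance Definition _ := gen_eqMixin (fterm n).
HB.instance Definition _ := gen_choiceMixin (fterm n).

Definition feqb : rel (fterm n) := fun x y => `[< feq x y >].

Lemma feqb_equiv : equiv_class_of feqb.
Proof.
split.
- by move=> x; apply/asboolP/feq_refl.
- by move=> x y; apply/asboolP/asboolP; apply: feq_sym.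
- by move=> y x z /asboolP H1 /asboolP H2; apply/asboolP/(feq_trans H1 H2).
Qed.

Canonical feq_equiv := EquivRelPack feqb_equiv.

Definition fquot := {eq_quot feq_equiv}.
HB.instance Definition _ := Choice.on fquot.

Definition fpi (x : fterm n) : fquot := \pi_fquot x.

Lemma fpiP x y : fpi x = fpi y <-> feq x y.
Proof. by split => [/eqmodP/asboolP | H] //; apply/eqmodP/asboolP. Qed.

Lemma fpiK (q : fquot) : fpi (repr q) = q.
Proof. exact: reprK. Qed.

Lemma freprP x : feq (repr (fpi x)) x.
Proof. by apply/fpiP; rewrite fpiK. Qed.

Lemma fquot_ind (Q : fquot -> Prop) : (forall x, Q (fpi x)) -> forall q, Q q.
Proof. by move=> H q; rewrite -(fpiK q). Qed.

Definition fq_add (p q : fquot) : fquot := fpi (FAdd (repr p) (repr q)).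
Definition fq_scale (c : K) (p : fquot) : fquot := fpi (FScale c (repr p)).
Definition fq_opp (p : fquot) : fquot := fq_scale (-1) p.
Definition fq_act (s : 'S_n) (p : fquot) : fquot := fpi (FAct s (repr p)).

Lemma fq_addE x y : fq_add (fpi x) (fpi y) = fpi (FAdd x y).
Proof. by apply/fpiP/feq_congAdd; apply: freprP. Qed.

Lemma fq_scaleE c x : fq_scale c (fpi x) = fpi (FScale c x).
Proof. by apply/fpiP/feq_congScale/freprP. Qed.

Lemma fq_actE s x : fq_act s (fpi x) = fpi (FAct s x).
Proof. by apply/fpiP/feq_congAct/freprP. Qed.

Fact fq_addA : associative fq_add.
Proof. by do 3![elim/fquot_ind => ?]; rewrite !fq_addE; apply/fpiP/feq_addA. Qed.
Fact fq_addC : commutative fq_add.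
Proof. by do 2![elim/fquot_ind => ?]; rewrite !fq_addE; apply/fpiP/feq_addC. Qed.
Fact fq_add0 : left_id (fpi (FZero n)) fq_add.
Proof. by elim/fquot_ind => ?; rewrite !fq_addE; apply/fpiP/feq_add0. Qed.
Fact fq_addN : left_inverse (fpi (FZero n)) fq_opp fq_add.
Proof.
elim/fquot_ind => ?; rewrite /fq_opp fq_scaleE !fq_addE.
exact/fpiP/feq_addN.
Qed.

HB.instance Definition _ :=
  GRing.isZmodule.Build fquot fq_addA fq_addC fq_add0 fq_addN.

Fact fq_scaleA a b v : fq_scale a (fq_scale b v) = fq_scale (a * b) v.
Proof. by elim/fquot_ind: v => ?; rewrite !fq_scaleE; apply/fpiP/feq_scaleA. Qed.
Fact fq_scale1 : left_id 1 fq_scale.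
Proof. by elim/fquot_ind => ?; rewrite !fq_scaleE; apply/fpiP/feq_scale1. Qed.
Fact fq_scaleDr : right_distributive fq_scale +%R.
Proof.
move=> c; do 2![elim/fquot_ind => ?].
rewrite [X in fq_scale _ X]fq_addE !fq_scaleE [RHS]fq_addE.
exact/fpiP/feq_scaleDr.
Qed.
Fact fq_scaleDl v : {morph fq_scale^~ v : a b / a + b}.
Proof.
elim/fquot_ind: v => ? a b; rewrite !fq_scaleE [RHS]fq_addE.
exact/fpiP/feq_scaleDl.
Qed.

HB.instance Definition _ := GRing.Zmodule_isLmodule.Build K fquot
  fq_scaleA fq_scale1 fq_scaleDr fq_scaleDl.

Lemma fq_linE c x y : c *: fpi x + fpi y = fpi (FAdd (FScale c x) y).
Proof. by rewrite -fq_addE -fq_scaleE. Qed.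

End Arity.

Definition fq_comp m n p (e : (m + n = p.+1)%N) (i : 'I_m)
  (x : fquot m) (y : fquot n) : fquot p := fpi (FComp e i (repr x) (repr y)).

Lemma fq_compE m n p (e : (m + n = p.+1)%N) i (x : fterm m) (y : fterm n) :
  fq_comp e i (fpi x) (fpi y) = fpi (FComp e i x y).
Proof. by apply/fpiP/feq_congComp; apply: freprP. Qed.

Definition free_operad : operad K.
Proof.
apply: (@Operad K (fun n => fquot n : lmodType K) fq_act (fpi FOne) fq_comp).
- move=> n s c; do 2![elim/fquot_ind => ?].
  by rewrite fq_linE !fq_actE fq_linE; apply/fpiP/feq_actLin.
- by move=> n; elim/fquot_ind => a; rewrite fq_actE; apply/fpiP/feq_act1.
- by move=> n s t; elim/fquot_ind => a; rewrite !fq_actE; apply/fpiP/feq_actM.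
- move=> m n p e i; elim/fquot_ind => b c; do 2![elim/fquot_ind => ?].
  by rewrite fq_linE !fq_compE fq_linE; apply/fpiP/feq_compLinL.
- move=> m n p e i; elim/fquot_ind => b c; do 2![elim/fquot_ind => ?].
  by rewrite fq_linE !fq_compE fq_linE; apply/fpiP/feq_compLinR.
- by move=> n e; elim/fquot_ind => a; rewrite fq_compE; apply/fpiP/feq_comp1l.
- by move=> n e i; elim/fquot_ind => a; rewrite fq_compE; apply/fpiP/feq_comp1r.
- move=> l m n p q r e1 e2 e3 e4 i j k; do 3![elim/fquot_ind => ?] => H.
  by rewrite !fq_compE; apply/fpiP/feq_compSeq.
- move=> l m n p q r e1 e2 e3 e4 i k k' i'.
  do 3![elim/fquot_ind => ?] => H1 H2 H3.
  by rewrite !fq_compE; apply/fpiP/(feq_compPar _ _ _ _ _ _ _ H1 H2 H3).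
- move=> m n p e i s t r; do 2![elim/fquot_ind => ?] => H.
  by rewrite [in RHS]fq_compE !fq_actE fq_compE; apply/fpiP/feq_compAct.
Defined.

Definition free_gen (x : E) : free_operad 2 := fpi (FGen x).

End FreeOperad.

(* For binary operations, a o (b, I) and a o (I, b). *)
Definition comp_bI (K : fieldType) (Q : operad K) (a b : Q 2) : Q 3 :=
  op_comp (erefl : 2 + 2 = 3.+1)%N ord0 a b.
Definition comp_Ib (K : fieldType) (Q : operad K) (a b : Q 2) : Q 3 :=
  op_comp (erefl : 2 + 2 = 3.+1)%N ord_max a b.

(* A quadratic operad P(E)/(R) is given by E and a sub-S_3-module R. *)
Record quadratic_data (K : fieldType) := QuadraticData {
  qd_gens : smodule K 2;
  qd_rels : subspace (free_operad qd_gens 3);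
  qd_rels_act : forall (s : 'S_3) x, qd_rels x -> qd_rels (op_act s x)
}.

Definition quadratic_operad (K : fieldType) (D : quadratic_data K) : operad K :=
  operad_quotient (generated_ideal (@qd_rels _ D)).

Section KoszulDual.
Variable K : fieldType.

(* The isomorphism P(E^v)(3) ~ P(E)(3)^* (x) sgn, as a pairing.  P(E)(3) is
   induced from the stabilizer S_2 of the last input, acting on the subspace
   of the a o (b, I), which is a copy of E (x) E; likewise for E^v.  The pairing
   is the S_3-equivariant extension of the evaluation of E^* (x) E^* on
   E (x) E, distinct cosets of S_2 being orthogonal.  As P(E)(3) is spanned by
   the translates of the a o (b, I), at most one B satisfies these conditions. *)
Definition dual_pairing (E : smodule K 2)
    (B : free_operad (sgn_dual E) 3 -> free_operad E 3 -> K) : Prop :=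
  [/\ forall y, linear (fun x => B x y : K^o),
      forall x, linear (B x : _ -> K^o),
      forall (s : 'S_3) x y, B (op_act s x) (op_act s y) = (-1) ^+ s * B x y,
      forall (f g : 'Hom(E, K^o)) (a b : E),
        B (comp_bI (free_gen (f : sgn_dual E)) (free_gen (g : sgn_dual E)))
          (comp_bI (free_gen a) (free_gen b)) = f a * g b &
      forall (f g : 'Hom(E, K^o)) (a b : E) (s : 'S_3), s ord_max != ord_max ->
        B (comp_bI (free_gen (f : sgn_dual E)) (free_gen (g : sgn_dual E)))
          (op_act s (comp_bI (free_gen a) (free_gen b))) = 0].

(* Existential on purpose: were there no such pairing, R^perp would be empty
   rather than everything. *)
Definition rels_orthogonal (D : quadratic_data K)
    (x : free_operad (sgn_dual (qd_gens D)) 3) : Prop :=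
  exists2 B, dual_pairing B & forall r, qd_rels D r -> B x r = 0.

Definition koszul_dual (D : quadratic_data K) : operad K :=
  operad_quotient (generated_ideal (@rels_orthogonal D)).

End KoszulDual.

(* Relations of arity 3 between two binary operations m and u (for the arrow),
   given by the elements that are to vanish. *)
Definition binary_rels (K : fieldType) :=
  forall Q : operad K, Q 2 -> Q 2 -> seq (Q 3).

Section Presentations.
Variables (K : fieldType) (rels : binary_rels K).

(* The generator m is indexed by true, the arrow by false. *)
Definition gens2 : smodule K 2 := free_smodule K bool 2.
Definition free_m : free_operad gens2 2 := free_gen (free_basis K 2 true).
Definition free_u : free_operad gens2 2 := free_gen (free_basis K 2 false).

Definition holds_rels (x : free_operad gens2 3) : Prop :=
  x \in rels free_m free_u.

Definition presented_data : quadratic_data K :=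
  @QuadraticData K gens2 (generated_subspace holds_rels)
    (@InSubAct _ _ _ holds_rels).

Definition presented_operad : operad K :=
  operad_quotient (generated_ideal holds_rels).

Definition presented_by (P : operad K) (m u : P 2) : Prop :=
  exists2 f : operad_morphism presented_operad P, operad_isomorphism f &
    f 2 (operad_proj _ free_m) = m /\ f 2 (operad_proj _ free_u) = u.

End Presentations.

Definition nearrow_rels (K : fieldType) : binary_rels K := fun Q m u =>
  [:: comp_bI u u - comp_Ib u u;
      comp_Ib u m - comp_bI m u;
      comp_bI m m - comp_Ib m m].

Definition nearrow_data (K : fieldType) : quadratic_data K :=
  presented_data (@nearrow_rels K).

Definition nearrow_operad (K : fieldType) : operad K :=
  quadratic_operad (nearrow_data K).

Definition nearrow_dual_rels (K : fieldType) : binary_rels K := fun Q m u =>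
  [:: comp_bI u u - comp_Ib u u;
      comp_bI m m - comp_Ib m m;
      comp_bI m u - comp_Ib u m;
      comp_bI u m;
      comp_Ib m u].

(* Main.v *)
Require Import Defs.
From HB Require Import structures.
From mathcomp Require Import all_boot all_order all_algebra all_fingroup.
From mathcomp Require Import boolp.
From mathcomp Require Import generic_quotient functions zify ring.

(** The S_2-module E freely generated by m and the arrow is isomorphic to its
    twisted dual E^* (x) sgn: up to the signs of permutations, the isomorphism
    reads off the coordinates of a linear form on the translates of the two
    generators ([of_dual], [to_dual]).  It extends to an isomorphism of free
    operads, so the theorem amounts to this: under that isomorphism, the
    annihilator of the relations of P and the five relations of the statement
    generate the same ideal ([quotient_map_iso]).

    Both inclusions are a computation in P(E)(3), once that space is known to
    be the free S_3-module on the eight monomials a o_i b, where i is 0 or 1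
    and a, b range over the two generators.

    - The translates of the monomials span, because a formal operadic
      expression without inputs vanishes, one with a single input is a multiple
      of the unit, one with two inputs is a generator, and so on
      ([low_arityP], [arity3_spanned]).
    - They are independent, because operations can be evaluated: the functions
      on planar binary trees carry two bilinear products, which make them an
      algebra over P(E), and evaluating an operation at the indicators of the
      leaves recovers its coefficients ([ev_feq], [coefs_mono]).

    In these coordinates the pairing of P(E^* (x) sgn)(3) with P(E)(3) becomes
    a diagonal form ([sgn_form]): the translate by s of a monomial a o_i b is
    paired with itself to (-1)^i times the sign of s.  The factor (-1)^i appears
    because a o_1 b is a cyclic, hence even, translate of (a.(0 1)) o_0 b, and
    the transposition acts on the dual with an extra sign.  The form satisfies
    the conditions that define the pairing ([pairing_dual]), and no other pairing
    does ([dual_pairing_unique]).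

    Finally, fix a permutation s and let d be the coefficients, on the eight
    monomials translated by s, of an element orthogonal to the relations of P.
    Orthogonality says that d takes opposite values on u o_0 u and u o_1 u, on
    m o_0 u and u o_1 m, and on m o_0 m and m o_1 m; nothing is imposed on
    u o_0 m and m o_1 u.  The space of such d is spanned by the five relations of
    the statement ([nearrow_rels_orthogonal], [orthogonal_in_dual_ideal]). *)

Set Implicit Arguments.
Unset Strict Implicit.
Unset Printing Implicit Defensive.

Import GRing.Theory.
Local Open Scope ring_scope.

(** * Linear maps *)

Section LinearMaps.
Variables (K : fieldType) (V W : lmodType K) (f : V -> W).
Hypothesis f_lin : linear f.

Lemma lin0 : f 0 = 0.
Proof. by move: (lin_sub f_lin 0 0); rewrite !subrr. Qed.

Lemma linD x y : f (x + y) = f x + f y.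
Proof. by rewrite -{1}[x]scale1r f_lin scale1r. Qed.

Lemma linZ c x : f (c *: x) = c *: f x.
Proof. by rewrite -[c *: x]addr0 f_lin lin0 addr0. Qed.

Lemma lin_sum (J : finType) (F : J -> V) : f (\sum_j F j) = \sum_j f (F j).
Proof. exact: (big_morph f linD lin0). Qed.

End LinearMaps.

(** For linear maps given by a proof rather than by a structure. *)
Lemma linfunE (K : fieldType) (V W : vectType K) (f : V -> W) :
  linear f -> linfun f =1 f.
Proof.
move=> f_lin x; pose fL : {linear V -> W} := HB.pack f (GRing.isLinear.Build _ _ _ _ f f_lin).
exact: (lfunE fL).
Qed.

(** * Permutations of few elements *)

Lemma ord2P (i : 'I_2) : i = ord0 \/ i = ord_max.
Proof. by case: i => [[|[|//]] lti]; [left | right]; apply: val_inj. Qed.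

Lemma S2P (s : 'S_2) : s = 1%g \/ s = tperm ord0 ord_max.
Proof.
have ne : s ord0 != s ord_max by rewrite (inj_eq perm_inj).
case: (ord2P (s ord0)) (ord2P (s ord_max)) ne => s0 [] s1; rewrite s0 s1 //= => _.
  by left; apply/permP => j; rewrite perm1; case: (ord2P j) => ->.
by right; apply/permP => j; case: (ord2P j) => ->; rewrite ?tpermL ?tpermR.
Qed.

(** This identity between numbers matches the two places where the sign of a
    transposition shows up: the exponent i in a o_i b, and the character of S_2. *)
Lemma S2_sign (s : 'S_2) : (s^-1 ord0)%g = s :> nat.
Proof.
by case: (S2P s) => ->; rewrite ?tpermV ?tpermL ?odd_tperm ?invg1 ?perm1 ?odd_perm1.
Qed.

Lemma S2_inj (s t : 'S_2) : (s^-1 ord0 = t^-1 ord0)%g -> s = t.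
Proof.
move/(congr1 val); rewrite /= !S2_sign.
by case: (S2P s) => ->; case: (S2P t) => ->; rewrite // odd_tperm odd_perm1.
Qed.

Lemma lift_perm_exists n (i j : 'I_n.+1) (s : 'S_n.+1) :
  s i = j -> exists t, s = lift_perm i j t.
Proof.
move=> si; pose h k := odflt k (unlift j (s (lift i k))).
have hE k : lift j (h k) = s (lift i k).
  rewrite /h; case: unliftP => [k' -> // | /eqP].
  by rewrite -si (inj_eq perm_inj) eq_sym (negbTE (neq_lift _ _)).
have h_inj : injective h.
  by move=> k k' /(congr1 (lift j)); rewrite !hE => /perm_inj/lift_inj.
exists (perm h_inj); apply/permP => k.
by case: (unliftP i k) => [k' | ] ->; rewrite ?lift_perm_id ?lift_perm_lift ?permE ?hE.
Qed.

(** * Permutations as maps on natural numbers *)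

(** Environments below are sequences indexed by all of nat, which spares the
    casts between the types of inputs of composites; so permutations are
    extended by the identity. *)
Definition perm_nat n (s : 'S_n) (j : nat) : nat :=
  if insub j is Some k then s k else j.

Lemma perm_natE n (s : 'S_n) (k : 'I_n) : perm_nat s k = s k.
Proof. by rewrite /perm_nat valK. Qed.

Lemma perm_nat_lt n (s : 'S_n) j : (j < n)%N -> (perm_nat s j < n)%N.
Proof. by move=> lt_jn; rewrite -[j]/(val (Ordinal lt_jn)) perm_natE. Qed.

Lemma perm_natM n (s t : 'S_n) j : perm_nat (s * t)%g j = perm_nat t (perm_nat s j).
Proof.
rewrite {1 3}/perm_nat; case: insubP => [k _ _ | ].
  by rewrite perm_natE permM.
by rewrite /perm_nat => /negbTE lt_jn; rewrite insubF.
Qed.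

Lemma perm_nat1 n j : perm_nat (1%g : 'S_n) j = j.
Proof. by rewrite /perm_nat; case: insubP => // k _ <-; rewrite perm1. Qed.

(** * Free S_n-modules *)

Section FreeSModuleTheory.
Variables (K : fieldType) (B : finType) (n : nat).
Local Notation M := (free_smodule K B n).

Lemma free_act_basisE s b (u : B * 'S_n) :
  (sm_act s (free_basis K n b) : {ffun _}) u = (u == (b, s))%:R.
Proof.
by case: u => b' t; rewrite !ffunE /= !xpair_eqE -eq_mulgV1.
Qed.

Lemma free_smodule_expand (x : M) :
  x = \sum_u (x : {ffun _}) u *: sm_act u.2 (free_basis K n u.1).
Proof.
apply/ffunP => u; rewrite sum_ffunE (bigD1 u) //= big1 ?addr0.
  by rewrite !ffunE /= mulgV eqxx [_ *: _]mulr1.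
move=> v ne_vu; rewrite ffunE free_act_basisE -surjective_pairing eq_sym.
by rewrite (negbTE ne_vu) scaler0.
Qed.

End FreeSModuleTheory.

(** * Composites of two binary operations *)

(** The input of a o_i b that is not an input of b. *)
Definition free_input (i : 'I_2) : 'I_3 := if i == ord0 then ord_max else ord0.

(** Every composite of translated operations is a translate of an untranslated
    one, but in a position i that depends on the translation of the outer
    operation.  For t = 1 and s the transposition this expresses a o (I, b) by
    composites a' o (b, I); for s = 1 it is the action of the stabilizer of the
    last input. *)
Lemma comp_bI_act (K : fieldType) (Q : operad K) (s t : 'S_2) (a b : Q 2%N) :
  comp_bI (op_act s a) (op_act t b) =
  op_act (lift_perm (free_input (s^-1 ord0)%g) ord_max t)
    (op_comp (erefl : 2 + 2 = 3.+1)%N (s^-1 ord0)%g a b).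
Proof.
set i := (s^-1 ord0)%g; have si : s i = ord0 by rewrite permKV.
rewrite /comp_bI -{1}si; apply: op_comp_act; split=> [j x ne_ji | j x] xE.
- have sj : s j = ord_max.
    by case: (ord2P (s j)) => // sj0; case/eqP: ne_ji; apply: (@perm_inj _ s); rewrite si.
  have -> : x = free_input i.
    apply: val_inj; rewrite /= xE /free_input.
    by case: (ord2P i) ne_ji => ->; case: (ord2P j) => ->.
  by rewrite lift_perm_id si sj.
- have -> : x = lift (free_input i) j.
    apply: val_inj; rewrite /= xE /free_input.
    by case: (ord2P i) => ->; case: (ord2P j) => ->.
  by rewrite lift_perm_lift si; case: (ord2P (t j)) => ->.
Qed.

(** * Free operads in arity at most 3 *)

Section FreeOperadLowArity.
Variables (K : fieldType) (E : smodule K 2).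
Local Notation F := (free_operad E).

(** The operad generated by E has no proper suboperad that contains E. *)
Lemma free_operad_ind (P : forall n, F n -> Prop) :
    (forall e, P 2 (free_gen e)) -> P 1 (op_one F) ->
    (forall m n p (e : (m + n = p.+1)%N) i x y,
      P m x -> P n y -> P p (op_comp e i x y)) ->
    (forall n s x, P n x -> P n (op_act s x)) ->
    (forall n, P n 0) ->
    (forall n c x y, P n x -> P n y -> P n (c *: x + y)) ->
  forall n x, P n x.
Proof.
move=> Pgen P1 Pcomp Pact P0 Plin n; elim/fquot_ind.
elim=> {n} [e || m n p e i x Px y Py | n s x Px | n | n x Px y Py | n c x Px].
- exact: Pgen.
- exact: P1.
- by rewrite -fq_compE; apply: Pcomp.
- by rewrite -fq_actE; apply: Pact.
- exact: P0.
- by rewrite -fq_addE -[fpi x]scale1r; apply: Plin.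
- by rewrite -fq_scaleE -[fq_scale _ _]addr0; apply: Plin.
Qed.

Lemma free_gen_linear : linear (@free_gen K E).
Proof.
by move=> c u v; rewrite [RHS]fq_linE; apply/fpiP/feq_genLin.
Qed.

Lemma free_gen_act s (e : E) : free_gen (sm_act s e) = op_act s (free_gen e).
Proof. by rewrite [RHS]fq_actE; apply/fpiP/feq_genAct. Qed.

Definition left_comb (x : F 3%N) : Prop :=
  exists a b : E, x = comp_bI (free_gen a) (free_gen b).

Lemma op_comp_gens_spanned (e : (2 + 2 = 3.+1)%N) i (a b : E) :
  in_submodule left_comb (op_comp e i (free_gen a) (free_gen b)).
Proof.
rewrite (eq_irrelevance e erefl); pose s : 'S_2 := tperm ord0 i.
have si : (s^-1 ord0)%g = i by rewrite tpermV tpermL.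
have := comp_bI_act s 1 (free_gen a) (free_gen b); rewrite si.
set r := lift_perm _ _ _ => /(congr1 (op_act r^-1%g)).
rewrite -op_actM mulgV !op_act1 => <-; rewrite -free_gen_act.
by apply: InSubAct; apply: InSubGen; do 2!eexists.
Qed.

(** In arity above 3 nothing is claimed: as there is no nonzero operation of
    arity 0, composites of arity at most 3 only involve operations of arity at
    most 3, apart from composites with zero. *)
Definition low_arity n : F n -> Prop :=
  match n return F n -> Prop with
  | 0 => fun x => x = 0
  | 1 => fun x => exists c, x = c *: op_one F
  | 2 => fun x => exists e : E, x = free_gen e
  | 3 => in_submodule left_comb
  | _ => fun=> True
  end.

Lemma low_arityP n (x : F n) : low_arity x.
Proof.
move: n x; apply: free_operad_ind.
- by move=> e; exists e.
- by exists 1; rewrite scale1r.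
- move=> m n p e i x y; case: m e i x => [|m] e i x; first by case: i.
  case: n e y => [|n] e y Px Py.
    (* y has arity 0, hence vanishes. *)
    have -> : op_comp e i x y = 0 by rewrite [y]Py; apply: (lin0 (op_comp_linr e i x)).
    case: p e => [|[|[|[|p]]]] // e; last exact: InSub0.
    - by exists 0; rewrite scale0r.
    - by exists 0; rewrite (lin0 free_gen_linear).
  case: n e y Py => [|n] e y Py.
    (* y has arity 1, hence is a multiple of the unit. *)
    have [c ->] := Py; rewrite (linZ (op_comp_linr e i x)).
    have em : p = m.+1 by lia.
    rewrite {p}em in e *.
    rewrite op_comp1r {y Py}.
    case: m i x Px e => [|[|[|m]]] //= i x Px e.
    - by have [d ->] := Px; exists (c * d); rewrite scalerA.
    - by have [d ->] := Px; exists (c *: d); rewrite (linZ free_gen_linear).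
    - by rewrite -[_ *: _]addr0; apply: InSubD => //; apply: InSub0.
  case: m e i x Px => [|m] e i x Px.
    (* Likewise for x. *)
    have [c ->] := Px; rewrite (linZ (op_comp_linl e i y)).
    have em : p = n.+2 by lia.
    rewrite {p}em in e *.
    rewrite (ord1 i) op_comp1l {x Px}.
    case: n y Py e => [|[|n]] //= y Py e.
    - by have [d ->] := Py; exists (c *: d); rewrite (linZ free_gen_linear).
    - by rewrite -[_ *: _]addr0; apply: InSubD => //; apply: InSub0.
  (* Both arities are at least 2; if the composite has arity at most 3, both are 2. *)
  case: m e i x Px => [|m] e i x Px; last first.
    by case: p e => [|[|[|[|p]]]] // e; lia.
  case: n e y Py => [|n] e y Py; last first.
    by case: p e => [|[|[|[|p]]]] // e; lia.
  move: (e); case: p e => [|[|[|[|p]]]] // e e'; try by lia.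
  have [[a ->] [b ->]] := (Px, Py); exact: op_comp_gens_spanned.
- move=> [|[|[|[|n]]]] // s x.
  + by move=> Px; rewrite [x]Px; apply: (lin0 (op_act_lin s)).
  + by move=> Px; rewrite (_ : s = 1%g) ?op_act1 //; apply/permP => j; rewrite !ord1.
  + by move=> [e ->]; exists (sm_act s e); rewrite free_gen_act.
  + exact: InSubAct.
- move=> [|[|[|[|n]]]] //.
  + by exists 0; rewrite scale0r.
  + by exists 0; rewrite (lin0 free_gen_linear).
  + exact: InSub0.
- move=> [|[|[|[|n]]]] // c x y.
  + by move=> Px Py; rewrite [x]Px [y]Py scaler0 addr0.
  + by move=> [a ->] [b ->]; exists (c * a + b); rewrite scalerA scalerDl.
  + by move=> [a ->] [b ->]; exists (c *: a + b); rewrite free_gen_linear.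
  + exact: InSubD.
Qed.

Lemma arity3_spanned (x : F 3%N) : in_submodule left_comb x.
Proof. exact: (low_arityP x). Qed.

End FreeOperadLowArity.

(** * Functoriality of free operads and of quotients *)

Section FreeMap.
Variables (K : fieldType) (E E' : smodule K 2) (f : E -> E').
Hypothesis f_lin : linear f.
Hypothesis f_act : forall s e, f (sm_act s e) = sm_act s (f e).

Fixpoint fterm_map n (x : fterm E n) : fterm E' n :=
  match x with
  | FGen e => FGen (f e)
  | FOne => FOne E'
  | FComp _ _ _ e i x y => FComp e i (fterm_map x) (fterm_map y)
  | FAct _ s x => FAct s (fterm_map x)
  | FZero n => FZero E' n
  | FAdd _ x y => FAdd (fterm_map x) (fterm_map y)
  | FScale _ c x => FScale c (fterm_map x)
  end.

Lemma fterm_map_feq n (x y : fterm E n) :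
  feq x y -> feq (fterm_map x) (fterm_map y).
Proof.
elim=> {n x y} /=; try by econstructor; eauto.
- by move=> c u v; rewrite f_lin; apply: feq_genLin.
- by move=> s u; rewrite f_act; apply: feq_genAct.
Qed.

Definition free_map_fun n (x : free_operad E n) : free_operad E' n :=
  fpi (fterm_map (repr x)).

Lemma free_map_funE n (x : fterm E n) : free_map_fun (fpi x) = fpi (fterm_map x).
Proof. exact/fpiP/fterm_map_feq/freprP. Qed.

Definition free_map : operad_morphism (free_operad E) (free_operad E').
Proof.
apply: (@OperadMorphism K _ _ free_map_fun).
- move=> n c; do 2![elim/fquot_ind => ?].
  by rewrite [X in free_map_fun X]fq_linE !free_map_funE [RHS]fq_linE.
- move=> n s; elim/fquot_ind => x.
  by rewrite [X in free_map_fun X]fq_actE !free_map_funE [RHS]fq_actE.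
- exact: free_map_funE.
- move=> m n p e i; do 2![elim/fquot_ind => ?].
  by rewrite [X in free_map_fun X]fq_compE !free_map_funE [RHS]fq_compE.
Defined.

Lemma free_map_gen e : free_map 2%N (free_gen e) = free_gen (f e).
Proof. exact: free_map_funE. Qed.

End FreeMap.

(** A morphism out of a free operad is determined by its values on generators. *)
Lemma free_mapK (K : fieldType) (E E' : smodule K 2) (f : E -> E') (g : E' -> E)
    (f_lin : linear f) (f_act : forall s e, f (sm_act s e) = sm_act s (f e))
    (g_lin : linear g) (g_act : forall s e, g (sm_act s e) = sm_act s (g e)) :
  cancel f g -> forall n (x : free_operad E n),
  free_map g_lin g_act n (free_map f_lin f_act n x) = x.
Proof.
move=> fK; apply: free_operad_ind.
- by move=> e; rewrite !free_map_gen fK.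
- by rewrite !om_one.
- by move=> m n p e i x y IHx IHy; rewrite !om_comp IHx IHy.
- by move=> n s x IHx; rewrite !om_act IHx.
- by move=> n; rewrite !(lin0 (@om_lin _ _ _ _ _)).
- by move=> n c x y IHx IHy; rewrite !om_lin IHx IHy.
Qed.

Lemma in_ideal_map (K : fieldType) (P Q : operad K) (f : operad_morphism P Q)
    (k : nat) (R : P k -> Prop) (S : Q k -> Prop) :
  (forall x, R x -> in_ideal S (f k x)) ->
  forall n (x : P n), in_ideal R x -> in_ideal S (f n x).
Proof.
move=> RS n x; elim=> {n x} [x /RS // | n | n c x y _ IHx _ IHy | n s x _ IHx |
  m n p e i x b _ IHx | m n p e i a x _ IHx].
- by rewrite (lin0 (@om_lin _ _ _ _ _)); apply: InIdeal0.
- by rewrite om_lin; apply: InIdealD.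
- by rewrite om_act; apply: InIdealAct.
- by rewrite om_comp; apply: InIdealCompL.
- by rewrite om_comp; apply: InIdealCompR.
Qed.

Section QuotientIso.
Variables (K : fieldType) (P Q : operad K) (k : nat).
Variables (R : P k -> Prop) (S : Q k -> Prop).
Local Notation PR := (operad_quotient (generated_ideal R)).
Local Notation QS := (operad_quotient (generated_ideal S)).

Definition quotient_map_fun (f : operad_morphism P Q) n (x : PR n) : QS n :=
  lpi _ (f n (repr x)).

Section QuotientMap.
Variable f : operad_morphism P Q.
Hypothesis RS : forall x, R x -> in_ideal S (f k x).

Lemma quotient_map_funE n (x : P n) :
  quotient_map_fun f (operad_proj (generated_ideal R) x) =
  operad_proj (generated_ideal S) (f n x).
Proof.
apply/lpiP; rewrite -(lin_sub (@om_lin _ _ _ f n)).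
apply: (in_ideal_map RS); exact: (@reprI _ _ (generated_ideal R n)).
Qed.

Lemma quotient_map_lin n : linear (@quotient_map_fun f n).
Proof.
move=> c; do 2![elim/lq_ind => ?]; rewrite -[X in quotient_map_fun _ X]lpi_linear.
by rewrite !quotient_map_funE om_lin; apply: lpi_linear.
Qed.

Lemma quotient_map_act n s (x : PR n) :
  quotient_map_fun f (op_act s x) = op_act s (quotient_map_fun f x).
Proof.
elim/lq_ind: x => x; rewrite [X in quotient_map_fun _ X]oq_actE.
by rewrite !quotient_map_funE om_act; apply/esym/oq_actE.
Qed.

Lemma quotient_map_one : quotient_map_fun f (op_one PR) = op_one QS.
Proof. by rewrite [LHS]quotient_map_funE om_one. Qed.

Lemma quotient_map_comp m n p (e : (m + n = p.+1)%N) i (x : PR m) (y : PR n) :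
  quotient_map_fun f (op_comp e i x y) =
  op_comp e i (quotient_map_fun f x) (quotient_map_fun f y).
Proof.
elim/lq_ind: x => x; elim/lq_ind: y => y.
rewrite [X in quotient_map_fun _ X]oq_compE.
by rewrite !quotient_map_funE om_comp; apply/esym/oq_compE.
Qed.

Definition quotient_map : operad_morphism PR QS :=
  OperadMorphism quotient_map_lin quotient_map_act quotient_map_one quotient_map_comp.

End QuotientMap.
End QuotientIso.

Lemma quotient_map_iso (K : fieldType) (P Q : operad K) (k : nat)
    (R : P k -> Prop) (S : Q k -> Prop)
    (f : operad_morphism P Q) (g : operad_morphism Q P)
    (RS : forall x, R x -> in_ideal S (f k x)) :
  (forall x, S x -> in_ideal R (g k x)) ->
  (forall n, cancel (f n) (g n)) -> (forall n, cancel (g n) (f n)) ->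
  operad_isomorphism (quotient_map RS).
Proof.
move=> SR fK gK n; exists (@quotient_map_fun _ _ _ _ S R g n).
- by elim/lq_ind => x; rewrite [quotient_map RS _ _]quotient_map_funE // quotient_map_funE // fK.
- by elim/lq_ind => x; rewrite quotient_map_funE // [LHS]quotient_map_funE // gK.
Qed.

(** * Algebras over a free operad *)

Section Evaluation.
Variables (K : fieldType) (E : smodule K 2) (A : lmodType K).

(** The structure of an algebra over the free operad on E: a linear map from E to
    the bilinear products on A, equivariant under exchange of the arguments. *)
Record algebra_action := AlgebraAction {
  aa_op :> E -> A -> A -> A;
  aa_lin : forall a b, linear (fun e => aa_op e a b);
  aa_linl : forall e b, linear (fun a => aa_op e a b);
  aa_linr : forall e a, linear (aa_op e a);
  aa_act : forall (s : 'S_2) e (v : nat -> A),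
    aa_op (sm_act s e) (v 0%N) (v 1%N) = aa_op e (v (s ord0)) (v (s ord_max))
}.

Variable g : algebra_action.

(** The arguments of x in the composite x o_i y, when v lists those of the
    composite and a is the value of y. *)
Definition plug (i n : nat) (v : nat -> A) (a : A) (j : nat) : A :=
  if j == i then a else v (outer_pos n i j).

Fixpoint ev n (x : fterm E n) (v : nat -> A) : A :=
  match x with
  | FGen e => g e (v 0%N) (v 1%N)
  | FOne => v 0%N
  | @FComp _ _ _ n' _ _ i x y =>
      ev x (plug i n' v (ev y (fun k => v (i + k)%N)))
  | FAct _ s x => ev x (fun j => v (perm_nat s j))
  | FZero _ => 0
  | FAdd _ x y => ev x v + ev y v
  | FScale _ c x => c *: ev x v
  end.

Lemma ev_ext n (x : fterm E n) v w :
  (forall j, (j < n)%N -> v j = w j) -> ev x v = ev x w.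
Proof.
elim: x v w => {n} /= [e || m n p e i x IHx y IHy | n s x IHx | n |
  n x IHx y IHy | n c x IHx] v w vw.
- by rewrite !vw.
- exact: vw.
- have lt_i := ltn_ord i.
  apply: IHx => j lt_jm; rewrite /plug; case: eqVneq => [_ | ne_ji].
    by apply: IHy => k lt_kn; apply: vw; lia.
  by apply: vw; rewrite /outer_pos; case: ifP; lia.
- by apply: IHx => j lt_jn; apply/vw/perm_nat_lt.
- by [].
- by rewrite (IHx v w) ?(IHy v w).
- by rewrite (IHx v w).
Qed.

(** Multilinearity is what makes evaluation compatible with the linearity of
    composition in its second operand. *)
Lemma ev_multilinear n (x : fterm E n) j c v v1 v2 : (j < n)%N ->
  (forall k, (k < n)%N -> k != j -> v k = v1 k /\ v k = v2 k) ->
  v j = c *: v1 j + v2 j -> ev x v = c *: ev x v1 + ev x v2.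
Proof.
elim: x j v v1 v2 => {n} /= [e || m n p e i x IHx y IHy | n s x IHx | n |
  n x IHx y IHy | n d x IHx] j v v1 v2 lt_j eq_v vj.
- case: j lt_j eq_v vj => [|[|//]] _ eq_v ->.
    by have [<- <-] := eq_v 1%N isT isT; apply: aa_linl.
  by have [<- <-] := eq_v 0%N isT isT; apply: aa_linr.
- by case: j lt_j eq_v vj.
- have lt_i := ltn_ord i.
  (* Argument j of the composite belongs either to y or to x. *)
  have [/andP[le_ij lt_jin] | out_j] := boolP ((i <= j) && (j < i + n))%N.
    apply: (IHx i) => //; rewrite /plug ?eqxx.
      move=> k lt_km ne_ki; rewrite (negbTE ne_ki); apply: eq_v.
        by rewrite /outer_pos; case: ifP; lia.
      by rewrite /outer_pos; case: ifP; lia.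
    apply: (IHy (j - i)%N); first by lia.
      by move=> k lt_kn ne_k; apply: eq_v; lia.
    by rewrite subnKC.
  have [j' [lt_j' ne_j' j'E]] : exists j', [/\ (j' < m)%N, j' != i & j = outer_pos n i j'].
    have [lt_ji | le_ij] := ltnP j i.
      by exists j; rewrite /outer_pos lt_ji; split=> //; lia.
    exists (j - n).+1; split; try lia.
    by rewrite /outer_pos; case: ifP; lia.
  apply: (IHx j') => //; rewrite /plug; last by rewrite (negbTE ne_j') -j'E.
  move=> k lt_km ne_kj; case: eqVneq => [_ | ne_ki].
    split; apply: ev_ext => l lt_ln.
      by case: (eq_v (i + l)%N) => //; lia.
    by case: (eq_v (i + l)%N) => //; lia.
  apply: eq_v; first by rewrite /outer_pos; case: ifP; lia.
  by rewrite j'E /outer_pos; do ?case: ifP; lia.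
- pose k := (s^-1 (Ordinal lt_j))%g.
  have sk : perm_nat s k = j by rewrite perm_natE permKV.
  apply: (IHx k) => //; last by rewrite sk.
  move=> l lt_l ne_lk; apply: eq_v; first exact: perm_nat_lt.
  apply: contraNneq ne_lk; rewrite -[l]/(val (Ordinal lt_l)) perm_natE => sl.
  by apply/eqP; congr val; apply: (@perm_inj _ s); rewrite permKV; apply: val_inj.
- by rewrite scaler0 addr0.
- by rewrite (IHx j v v1 v2) // (IHy j v v1 v2) // scalerDr addrACA.
- by rewrite (IHx j v v1 v2) // scalerDr !scalerA mulrC.
Qed.

(** Evaluation respects each axiom of operads: composition substitutes a value
    for an argument, so the axioms become identities between environments. *)
Lemma ev_feq n (x y : fterm E n) : feq x y -> ev x =1 ev y.
Proof.
elim=> {n x y} //=.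
- by move=> n x y _ IH v; rewrite IH.
- by move=> n x y z _ IH1 _ IH2 v; rewrite IH1 IH2.
- move=> m n p e i x x' y y' _ IHx _ IHy v; rewrite IHx.
  by congr (ev x' (plug _ _ _ _)); apply: IHy.
- by move=> n s x x' _ IHx v; rewrite IHx.
- by move=> n x x' y y' _ IHx _ IHy v; rewrite IHx IHy.
- by move=> n c x x' _ IHx v; rewrite IHx.
- by move=> n x y z v; rewrite addrA.
- by move=> n x y v; rewrite addrC.
- by move=> n x v; rewrite add0r.
- by move=> n x v; rewrite scaleN1r addNr.
- by move=> n c d x v; rewrite scalerA.
- by move=> n x v; rewrite scale1r.
- by move=> n c x y v; rewrite scalerDr.
- by move=> n c d x v; rewrite scalerDl.
- by move=> c u w v; rewrite (aa_lin g).
- move=> s u v; rewrite (aa_act g).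
  by rewrite (perm_natE s ord0) (perm_natE s ord_max).
- by move=> n x v; apply: ev_ext => j _; rewrite perm_nat1.
- by move=> n s t x v; apply: ev_ext => j _; rewrite perm_natM.
- (* linearity in the inner operation *)
  move=> m n p e i a c x y v; apply: (@ev_multilinear _ a i) => //.
    by move=> k _ ne_ki; rewrite /plug (negbTE ne_ki).
  by rewrite /plug eqxx.
- move=> n e i a v; apply: ev_ext => j _; rewrite /plug.
  case: eqVneq => [-> | ne_ji]; first by rewrite addn0.
  by congr (v _); rewrite /outer_pos; case: ifP; lia.
- (* sequential associativity: the argument h of a is fed either by b, some
     argument of which is fed by c, or directly *)
  move=> l m n p q r e1 e2 e3 e4 i j k a b c kE v.
  have [lt_i lt_j] := (ltn_ord i, ltn_ord j).
  apply: ev_ext => h lt_h; rewrite /plug; case: eqVneq => [_ | ne_hi].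
    apply: ev_ext => h' lt_h'; rewrite kE eqn_add2l; case: eqVneq => [_ | ne_h'j].
      by apply: ev_ext => k' _; rewrite addnA.
    by congr (v _); rewrite /outer_pos; do ?case: ifP; lia.
  rewrite ifF; last by apply/negbTE/eqP; rewrite kE /outer_pos; case: ifP; lia.
  by congr (v _); rewrite kE /outer_pos; do ?case: ifP; lia.
- (* parallel associativity: the argument h of a is fed by b, by c, or directly *)
  move=> l m n p q r e1 e2 e3 e4 i k k' i' a b c lt_ik k'E i'E v.
  have [lt_k lt_k'] := (ltn_ord k, ltn_ord k').
  apply: ev_ext => h lt_h; rewrite /plug i'E.
  have [-> | ne_hi] := eqVneq h i.
    rewrite ifF; last by apply/negbTE/eqP; lia.
    rewrite ifT; last by apply/eqP; rewrite /outer_pos; case: ifP; lia.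
    apply: ev_ext => h' lt_h'; rewrite ifF; last by apply/negbTE/eqP; lia.
    by congr (v _); rewrite /outer_pos; case: ifP; lia.
  have [-> | ne_hk] := eqVneq h k.
    rewrite ifT; last by apply/eqP; rewrite /outer_pos; case: ifP; lia.
    apply: ev_ext => h' lt_h'; rewrite ifF; last by apply/negbTE/eqP; lia.
    by congr (v _); rewrite /outer_pos; case: ifP; lia.
  rewrite !ifF.
  - by congr (v _); rewrite /outer_pos; do ?case: ifP; lia.
  - by apply/negbTE/eqP; rewrite /outer_pos; case: ifP; lia.
  - by apply/negbTE/eqP; rewrite /outer_pos; case: ifP; lia.
- move=> m n p e i s t r a b [r_out r_in] v.
  have lt_i := ltn_ord i.
  apply: ev_ext => h lt_h; rewrite -[h]/(val (Ordinal lt_h)) perm_natE /plug.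
  set j := Ordinal lt_h; have [-> | ne_ji] := eqVneq j i.
    rewrite !eqxx; apply: ev_ext => h' lt_h'.
    rewrite -[h']/(val (Ordinal lt_h')) perm_natE; congr (v _).
    have lt_p : (i + h' < p)%N by lia.
    by rewrite -[X in perm_nat r X]/(val (Ordinal lt_p)) perm_natE (r_in (Ordinal lt_h')).
  rewrite !ifF; try by apply/negbTE; rewrite ?(inj_eq val_inj) ?(inj_eq perm_inj).
  congr (v _).
  have lt_p : (outer_pos n i j < p)%N.
    by move: ne_ji; rewrite -(inj_eq val_inj) /= /outer_pos; case: ifP; lia.
  by rewrite -[X in perm_nat r X]/(val (Ordinal lt_p)) perm_natE (r_out j).
Qed.

End Evaluation.

Section EvaluationQuotient.
Variables (K : fieldType) (E : smodule K 2) (A : lmodType K).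
Variable g : algebra_action E A.
Local Notation F := (free_operad E).

Definition eval n (x : F n) (v : nat -> A) : A := ev g (repr x) v.

Lemma evalE n (x : fterm E n) v : eval (fpi x) v = ev g x v.
Proof. exact/ev_feq/freprP. Qed.

Lemma eval_linear n v : linear (fun x : F n => eval x v).
Proof.
by move=> c; do 2![elim/fquot_ind => ?]; rewrite [X in eval X]fq_linE !evalE.
Qed.

Lemma eval_gen e v : eval (free_gen e) v = g e (v 0%N) (v 1%N).
Proof. exact: evalE. Qed.

Lemma eval_act n s (x : F n) v :
  eval (op_act s x) v = eval x (fun j => v (perm_nat s j)).
Proof. by elim/fquot_ind: x => x; rewrite [X in eval X]fq_actE !evalE. Qed.

Lemma eval_comp m n p (e : (m + n = p.+1)%N) (i : 'I_m) (x : F m) (y : F n) v :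
  eval (op_comp e i x y) v =
  eval x (plug i n v (eval y (fun k => v (i + k)%N))).
Proof.
by elim/fquot_ind: x => x; elim/fquot_ind: y => y; rewrite [X in eval X]fq_compE !evalE.
Qed.

End EvaluationQuotient.

(** * The algebra of functions on trees *)

(** Planar binary trees with numbered leaves and two kinds of nodes stand for the
    iterated products of variables in the free algebra with two products. *)
Inductive tree := Leaf of nat | Node of bool & tree & tree.

Section TreeAction.
Variable K : fieldType.
Local Notation A := (tree -> K^o).
Local Notation E := (gens2 K).

(** The two products of functions on trees send a, b to the function
    Node c l r |-> a l * b r, supported on the trees whose root is of the given
    kind.  Allowing all functions gives a completion of the free algebra, in which
    no finiteness has to be maintained. *)
Definition tree_op (e : E) (a b : A) : A := fun w =>
  if w is Node c l r then
    \sum_(s : 'S_2) (e : {ffun _}) (c, s) *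
      ((if s ord0 == ord0 then a else b) l * (if s ord_max == ord0 then a else b) r)
  else 0.

Fact tree_op_lin a b : linear (fun e => tree_op e a b).
Proof.
move=> c e f; apply/funext => -[j | d l r] /=; rewrite !fctE /=.
  by rewrite scaler0 addr0.
rewrite scaler_sumr -big_split /=; apply: eq_bigr => s _.
by rewrite !ffunE /GRing.scale /=; ring.
Qed.

Fact tree_op_linl e b : linear (fun a => tree_op e a b).
Proof.
move=> c a a'; apply/funext => -[j | d l r] /=; rewrite !fctE /=.
  by rewrite scaler0 addr0.
rewrite scaler_sumr -big_split /=; apply: eq_bigr => s _.
by case: (S2P s) => ->; rewrite ?perm1 ?tpermL ?tpermR /= /GRing.scale /=; ring.
Qed.

Fact tree_op_linr e a : linear (tree_op e a).
Proof.
move=> c b b'; apply/funext => -[j | d l r] /=; rewrite !fctE /=.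
  by rewrite scaler0 addr0.
rewrite scaler_sumr -big_split /=; apply: eq_bigr => s _.
by case: (S2P s) => ->; rewrite ?perm1 ?tpermL ?tpermR /= /GRing.scale /=; ring.
Qed.

Fact tree_op_act (s : 'S_2) e (v : nat -> A) :
  tree_op (sm_act s e) (v 0%N) (v 1%N) = tree_op e (v (s ord0)) (v (s ord_max)).
Proof.
have pickE (j : 'I_2) : (if j == ord0 then v 0%N else v 1%N) = v j.
  by case: (ord2P j) => ->.
apply/funext => -[j | d l r] //=; rewrite (reindex_inj (mulIg s)) /=.
apply: eq_bigr => t _; rewrite ffunE /= mulgK !permM; congr (_ * (_ * _)).
  by case: (ord2P (t ord0)) => ->; rewrite pickE.
by case: (ord2P (t ord_max)) => ->; rewrite pickE.
Qed.

Definition tree_action : algebra_action E A :=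
  AlgebraAction tree_op_lin tree_op_linl tree_op_linr tree_op_act.

Lemma tree_op_basis b (x y : A) w :
  tree_op (free_basis K 2 b) x y w =
  if w is Node c l r then (c == b)%:R * (x l * y r) else 0.
Proof.
case: w => //= c l r; rewrite (bigD1 1%g) //= big1 ?addr0 => [|s ne_s1].
  by rewrite ffunE !perm1 xpair_eqE !eqxx andbT.
by rewrite ffunE xpair_eqE (negbTE ne_s1) andbF mul0r.
Qed.

End TreeAction.

(** * A basis of ternary operations, and the signed form *)

(** (i, (b, c)) stands for b o_i c, where b and c are true for m and false for the
    arrow. *)
Definition monomial := ('I_2 * (bool * bool))%type.

Section Arity3.
Variable K : fieldType.
Local Notation E := (gens2 K).
Local Notation F := (free_operad E).
Local Notation M := (free_smodule K monomial 3).
Local Notation gen b := (free_gen (free_basis K 2 b)).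

Definition mono (k : monomial) : F 3%N :=
  op_comp (erefl : 2 + 2 = 3.+1)%N k.1 (gen k.2.1) (gen k.2.2).

Definition leaf (j : nat) (w : tree) : K^o := if w is Leaf k then (k == j)%:R else 0.

Definition mono_tree (k : monomial) : tree :=
  if k.1 == ord0 then Node k.2.1 (Node k.2.2 (Leaf 0) (Leaf 1)) (Leaf 2)
  else Node k.2.1 (Leaf 0) (Node k.2.2 (Leaf 1) (Leaf 2)).

Local Arguments tree_op : simpl never.

(** The coefficient at a translate by s is read after translating back by s, so
    that equivariance is immediate and only trees with leaves 0, 1, 2 in this
    order are needed. *)
Definition coefs (x : F 3%N) : M :=
  [ffun u : monomial * 'S_3 =>
     eval (tree_action K) (op_act u.2^-1%g x) leaf (mono_tree u.1)].

Lemma coefs_linear : linear coefs.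
Proof.
move=> c x y; apply/ffunP => u; rewrite !ffunE.
rewrite (op_act_lin _ c x y) (eval_linear _ leaf c) !fctE.
by [].
Qed.

Lemma coefs_act s x : coefs (op_act s x) = sm_act s (coefs x).
Proof. by apply/ffunP => u; rewrite !ffunE -op_actM invMg invgK. Qed.

(** With equivariance, this makes the translates of the monomials linearly
    independent. *)
Lemma coefs_mono k : coefs (mono k) = free_basis K 3 k.
Proof.
have perm_nat_eq1 (t : 'S_3) :
    (0 == perm_nat t 0)%:R * ((1 == perm_nat t 1)%:R * (2 == perm_nat t 2)%:R)
    = (t == 1%g)%:R :> K.
  rewrite -!natrM !mulnb; congr (_%:R : K); congr nat_of_bool.
  apply/and3P/eqP => [[/eqP t0 /eqP t1 /eqP t2] | ->]; last by rewrite !perm_nat1.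
  apply/permP => j; rewrite perm1; apply: val_inj; rewrite /= -perm_natE.
  by case: j => [[|[|[|//]]] ?] /=.
apply/ffunP => -[[i' [b' c']] t]; case: k => i [b c]; rewrite !ffunE.
rewrite eval_act eval_comp eval_gen /= tree_op_basis eval_gen /= /mono_tree /=.
rewrite !xpair_eqE -[(t == 1)%g]invg_eq1.
rewrite -!mulnb !natrM -perm_nat_eq1.
case: (ord2P i') => ->; case: (ord2P i) => -> /=; rewrite /plug /= ?tree_op_basis /=.
all: rewrite ?mul1r ?mulr0 ?mul0r //.
all: rewrite -?[outer_pos _ _ _]/2%N -?[outer_pos _ _ _]/0%N.
all: ring.
Qed.

Lemma coefs_act_mono s k :
  coefs (op_act s (mono k)) = sm_act s (free_basis K 3 k).
Proof. by rewrite coefs_act coefs_mono. Qed.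

(** Where [comp_bI_act] places the composite of two translated generators. *)
Definition comb_coord (a b : bool * 'S_2) : monomial * 'S_3 :=
  (((a.2^-1 ord0)%g, (a.1, b.1)),
   lift_perm (free_input (a.2^-1 ord0)%g) ord_max b.2).

Lemma comp_bI_basis (a b : bool * 'S_2) :
  comp_bI (free_gen (sm_act a.2 (free_basis K 2 a.1)))
          (free_gen (sm_act b.2 (free_basis K 2 b.1))) =
  op_act (comb_coord a b).2 (mono (comb_coord a b).1).
Proof. by rewrite !free_gen_act comp_bI_act. Qed.

Lemma comp_bI_expand (a b : E) :
  comp_bI (free_gen a) (free_gen b) =
  \sum_u \sum_v ((a : {ffun _}) u * (b : {ffun _}) v) *:
    op_act (comb_coord u v).2 (mono (comb_coord u v).1).
Proof.
have sumE (e : E) : free_gen e = \sum_u (e : {ffun _}) u *: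
    free_gen (sm_act u.2 (free_basis K 2 u.1)).
  rewrite {1}(free_smodule_expand e) (lin_sum (@free_gen_linear _ _)).
  by apply: eq_bigr => u _; rewrite (linZ (@free_gen_linear _ _)).
rewrite {1}(sumE a) {1}(sumE b) /comp_bI.
rewrite (lin_sum (op_comp_linl _ _ _)); apply: eq_bigr => u _.
rewrite (linZ (op_comp_linl _ _ _)) (lin_sum (op_comp_linr _ _ _)) scaler_sumr.
apply: eq_bigr => v _; rewrite (linZ (op_comp_linr _ _ _)) scalerA.
by rewrite -comp_bI_basis.
Qed.

(** The right-hand side is linear and equivariant in x and right on monomials, hence
    on the left combs, which span together with their translates. *)
Lemma coefs_expand (x : F 3%N) :
  x = \sum_u (coefs x : {ffun _}) u *: op_act u.2 (mono u.1).
Proof.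
pose rec (X : M) : F 3%N := \sum_u (X : {ffun _}) u *: op_act u.2 (mono u.1).
have rec_lin : linear rec.
  move=> c X Y; rewrite /rec scaler_sumr -big_split /=; apply: eq_bigr => u _.
  by rewrite !ffunE scalerDl scalerA.
have rec_basis (u : monomial * 'S_3) :
    rec (sm_act u.2 (free_basis K 3 u.1)) = op_act u.2 (mono u.1).
  rewrite /rec (bigD1 u) //= big1 ?addr0 => [|v ne_vu].
    by rewrite free_act_basisE -surjective_pairing eqxx scale1r.
  by rewrite free_act_basisE -surjective_pairing (negbTE ne_vu) scale0r.
rewrite -[RHS]/(rec (coefs x)).
have rec_act s X : rec (sm_act s X) = op_act s (rec X).
  rewrite {1}(free_smodule_expand X) (lin_sum (sm_act_lin s)) (lin_sum rec_lin).
  rewrite (lin_sum (op_act_lin s)); apply: eq_bigr => u _.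
  rewrite (linZ (sm_act_lin s)) (linZ rec_lin) (linZ (op_act_lin s)) -sm_actM.
  by rewrite (rec_basis (u.1, u.2 * s)%g) op_actM.
elim: (arity3_spanned x) => {x} [x [a [b ->]] | | c x y _ IHx _ IHy | s x _ IHx].
- rewrite comp_bI_expand (lin_sum coefs_linear) (lin_sum rec_lin).
  apply: eq_bigr => u _; rewrite (lin_sum coefs_linear) (lin_sum rec_lin).
  apply: eq_bigr => v _; rewrite (linZ coefs_linear) (linZ rec_lin).
  by rewrite coefs_act_mono rec_basis.
- by rewrite (lin0 coefs_linear) (lin0 rec_lin).
- by rewrite coefs_linear rec_lin -IHx -IHy.
- by rewrite coefs_act rec_act -IHx.
Qed.

(** The Koszul dual pairing in the coordinates given by the monomials. *)
Definition sgn_form (X Y : M) : K :=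
  \sum_(u : monomial * 'S_3)
    (-1) ^+ u.1.1 * (-1) ^+ u.2 * (X : {ffun _}) u * (Y : {ffun _}) u.

Lemma sgn_form_linearl Y : linear (fun X => sgn_form X Y : K^o).
Proof.
have distr : forall k s t x x' y : K,
    s * t * (k * x + x') * y = k * (s * t * x * y) + s * t * x' * y.
  by move=> *; ring.
move=> c X X'; rewrite /sgn_form scaler_sumr -big_split; apply: eq_bigr => u _.
by rewrite !ffunE; apply: distr.
Qed.

Lemma sgn_form_linearr X : linear (sgn_form X : _ -> K^o).
Proof.
have distr : forall k s t x y y' : K,
    s * t * x * (k * y + y') = k * (s * t * x * y) + s * t * x * y'.
  by move=> *; ring.
move=> c Y Y'; rewrite /sgn_form scaler_sumr -big_split; apply: eq_bigr => u _.
by rewrite !ffunE; apply: distr.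
Qed.

Lemma sgn_form_act s X Y :
  sgn_form (sm_act s X) (sm_act s Y) = (-1) ^+ s * sgn_form X Y.
Proof.
have mul_s : injective (fun u : monomial * 'S_3 => (u.1, u.2 * s)%g).
  by move=> [k t] [k' t'] [-> /mulIg->].
rewrite /sgn_form (reindex_inj mul_s) mulr_sumr; apply: eq_bigr => u _.
rewrite !ffunE /= mulgK -surjective_pairing odd_permM signr_addb !mulrA; congr (_ * _ * _).
by rewrite mulrC mulrA.
Qed.

Lemma sgn_form_basis k s k' t :
  sgn_form (sm_act s (free_basis K 3 k)) (sm_act t (free_basis K 3 k')) =
  (-1) ^+ k.1 * (-1) ^+ s * ((k, s) == (k', t))%:R.
Proof.
rewrite /sgn_form (bigD1 (k, s)) //= big1 ?addr0 => [|u ne_u].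
  by rewrite !free_act_basisE eqxx mulr1.
by rewrite free_act_basisE (negbTE ne_u) mulr0 mul0r.
Qed.

Lemma comb_coord_inj a b a' b' : comb_coord a b = comb_coord a' b' -> a = a' /\ b = b'.
Proof.
case: a a' b b' => [a s] [a' s'] [b t] [b' t'].
rewrite /comb_coord /= => -[/S2_inj-> -> ->] /= e; split=> //; congr (_, _).
apply/permP => j; apply: (@lift_inj _ ord_max).
by rewrite -!(lift_perm_lift (free_input (s'^-1 ord0)%g)) e.
Qed.

(** The sign (-1)^i of the position comes from a and the sign of the permutation
    from b, as the cyclic permutations that occur are even: the form is the tensor
    square of the signed form on E. *)
Lemma sgn_form_left_comb a b a' b' :
  sgn_form (coefs (op_act (comb_coord a b).2 (mono (comb_coord a b).1)))
    (coefs (op_act (comb_coord a' b').2 (mono (comb_coord a' b').1))) =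
  (-1) ^+ a.2 * (-1) ^+ b.2 * ((a == a') && (b == b'))%:R.
Proof.
rewrite !coefs_act_mono sgn_form_basis /= S2_sign odd_lift_perm.
congr (_ * _ * _%:R).
  by congr ((-1) ^+ nat_of_bool _); case: (ord2P (a.2^-1 ord0)%g) => ->.
congr nat_of_bool; apply/eqP/andP => [/comb_coord_inj[-> ->] // | [/eqP-> /eqP->] //].
Qed.

(** The inputs of b are never sent to the last one, which thus determines the coset
    of the stabilizer. *)
Lemma sgn_form_left_comb0 a b a' b' (s : 'S_3) : s ord_max != ord_max ->
  sgn_form (coefs (op_act (comb_coord a b).2 (mono (comb_coord a b).1)))
    (coefs (op_act s (op_act (comb_coord a' b').2 (mono (comb_coord a' b').1)))) = 0.
Proof.
move=> ne_s; rewrite -op_actM !coefs_act_mono sgn_form_basis [_ == _]negbTE ?mulr0 //.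
apply: contraNneq ne_s; rewrite /comb_coord => -[<- _ _] /(congr1 (fun t : 'S_3 => t _)) e.
move: (e (free_input (a.2^-1 ord0)%g)).
by rewrite permM !lift_perm_id => <-.
Qed.
End Arity3.

(** * The Koszul dual pairing *)

(** By equivariance a pairing is determined by its values on pairs of a left comb
    and a translate of another.  If the translation fixes the last input, it acts
    on the inner operation and the value is prescribed; otherwise the value is 0. *)
Lemma dual_pairing_unique (K : fieldType) (E : smodule K 2)
    (B B' : free_operad (sgn_dual E) 3%N -> free_operad E 3%N -> K) :
  dual_pairing B -> dual_pairing B' -> B =2 B'.
Proof.
move=> [Bl Br Ba B1 B0] [Bl' Br' Ba' B1' B0'] x.
elim: (arity3_spanned x) => {x} [x [f [g ->]] | | c x x' _ IHx _ IHx' | s x _ IHx] y.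
- rewrite -[y]op_act1; move: 1%g => s.
  elim: (arity3_spanned y) s => {y} [y [a [b ->]] | | c y y' _ IHy _ IHy' | t y _ IHy] s.
  + have [s_max | ne_s] := eqVneq (s ord_max) ord_max; last by rewrite B0 ?B0'.
    have [t ->] := lift_perm_exists s_max.
    have /esym := comp_bI_act 1 t (free_gen a) (free_gen b).
    rewrite invg1 perm1 op_act1 -free_gen_act => e.
    by rewrite [op_act _ _]e B1 B1'.
  + by rewrite (lin0 (op_act_lin s)) (lin0 (Br _)) (lin0 (Br' _)).
  + by rewrite (op_act_lin s) Br Br' IHy IHy'.
  + by rewrite -op_actM.
- by rewrite (lin0 (Bl y)) (lin0 (Bl' y)).
- by rewrite (Bl y) (Bl' y) IHx IHx'.
- by rewrite -[y](op_act1) -(mulVg s) op_actM Ba Ba' IHx.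
Qed.

Lemma sgn_dual_actE (K : fieldType) n (E : smodule K n) s (f : sgn_dual E) x :
  (sm_act s f : 'Hom(E, K^o)) x = (-1) ^+ s * (f : 'Hom(E, K^o)) (sm_act s^-1%g x).
Proof.
rewrite /= linfunE // => c y z; rewrite sm_act_lin linearP mulrDr /=.
by congr (_ + _); apply: mulrCA.
Qed.

Section SelfDuality.
Variable K : fieldType.
Local Notation E := (gens2 K).
Local Notation Ed := (sgn_dual E).
Local Notation vec u := (sm_act u.2 (free_basis K 2 u.1) : E).

(** The sign makes the map equivariant for the action twisted by sgn; it sends the
    dual basis elements of m and the arrow to m and the arrow. *)
Definition of_dual (f : Ed) : E :=
  [ffun u : bool * 'S_2 => (-1) ^+ u.2 * (f : 'Hom(E, K^o)) (vec u)].

Lemma of_dual_linear : linear of_dual.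
Proof.
move=> c f g; apply/ffunP => u; rewrite !ffunE add_lfunE scale_lfunE mulrDr.
by congr (_ + _); apply: mulrCA.
Qed.

Lemma of_dual_act s f : of_dual (sm_act s f) = sm_act s (of_dual f).
Proof.
apply/ffunP => u; rewrite !ffunE sgn_dual_actE mulrA -sm_actM.
by rewrite odd_permM odd_permV signr_addb.
Qed.

Definition to_dual_fun (e x : E) : K^o :=
  \sum_(u : bool * 'S_2) (-1) ^+ u.2 * (e : {ffun _}) u * (x : {ffun bool * 'S_2 -> K^o}) u.

Lemma to_dual_fun_linear e : linear (to_dual_fun e).
Proof.
move=> c x y; rewrite /to_dual_fun scaler_sumr -big_split; apply: eq_bigr => u _.
by rewrite !ffunE mulrDr; congr (_ + _); apply: mulrCA.
Qed.

Definition to_dual (e : E) : Ed := linfun (to_dual_fun e).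

Lemma to_dualE e x : (to_dual e : 'Hom(E, K^o)) x = to_dual_fun e x.
Proof. exact/linfunE/to_dual_fun_linear. Qed.

Lemma to_dual_linear : linear to_dual.
Proof.
move=> c e f; apply/lfunP => x; rewrite add_lfunE scale_lfunE !to_dualE.
rewrite /to_dual_fun scaler_sumr -big_split; apply: eq_bigr => u _.
have distr : forall k s x x' y : K, s * (k * x + x') * y = k * (s * x * y) + s * x' * y.
  by move=> *; ring.
by rewrite !ffunE; apply: distr.
Qed.

Lemma to_dualK : cancel to_dual of_dual.
Proof.
move=> e; apply/ffunP => u; rewrite ffunE to_dualE /to_dual_fun (bigD1 u) //= big1.
  rewrite addr0 free_act_basisE -surjective_pairing eqxx mulr1 mulrA.
  by rewrite -signr_addb addbb mul1r.
move=> v ne_vu; rewrite free_act_basisE -surjective_pairing (negbTE ne_vu).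
by rewrite mulr0.
Qed.

Lemma of_dualK : cancel of_dual to_dual.
Proof.
move=> f; apply/lfunP => x; rewrite to_dualE /to_dual_fun {2}(free_smodule_expand x).
rewrite linear_sum; apply: eq_bigr => u _; rewrite linearZ ffunE mulrA.
by rewrite -signr_addb addbb mul1r mulrC.
Qed.

Lemma to_dual_act s e : to_dual (sm_act s e) = sm_act s (to_dual e).
Proof. by apply: (can_inj of_dualK); rewrite of_dual_act !to_dualK. Qed.

Definition free_of_dual := free_map of_dual_linear of_dual_act.
Definition free_to_dual := free_map to_dual_linear to_dual_act.

Lemma free_to_dualK n : cancel (free_to_dual n) (free_of_dual n).
Proof. exact/free_mapK/to_dualK. Qed.

Lemma free_of_dualK n : cancel (free_of_dual n) (free_to_dual n).
Proof. exact/free_mapK/of_dualK. Qed.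

(** Orthogonality to a submodule amounts to the vanishing, for all s, of the form
    at the translates by s of its generators. *)
Definition act_form (s : 'S_3) (x y : free_operad E 3%N) : K^o :=
  sgn_form (coefs x) (coefs (op_act s y)).

Lemma act_form_linearl s y : linear (fun x => act_form s x y).
Proof. by move=> c x x'; rewrite /act_form (coefs_linear c) (sgn_form_linearl _ c). Qed.

Lemma act_form_linearr s x : linear (act_form s x).
Proof.
move=> c y y'; rewrite /act_form (op_act_lin s c y) (coefs_linear c).
exact: sgn_form_linearr.
Qed.

Lemma act_form_act s t x y : act_form s x (op_act t y) = act_form (t * s)%g x y.
Proof. by rewrite /act_form op_actM. Qed.

Lemma act_form_mono (k k' : monomial) (s : 'S_3) :
  act_form s (mono K k) (mono K k') = (-1) ^+ k.1 * ((k == k') && (s == 1%g))%:R.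
Proof.
rewrite /act_form -[mono K k]op_act1 !coefs_act_mono sgn_form_basis odd_perm1 mulr1.
by rewrite xpair_eqE [1%g == _]eq_sym.
Qed.

Lemma act_form_coefs (x : free_operad E 3%N) (k : monomial) (s : 'S_3) :
  act_form s x (mono K k) = (-1) ^+ k.1 * (-1) ^+ s * (coefs x : {ffun _}) (k, s).
Proof.
rewrite /act_form coefs_act_mono /sgn_form (bigD1 (k, s)) //= big1 ?addr0 => [|u ne_u].
  by rewrite free_act_basisE eqxx mulr1.
by rewrite free_act_basisE (negbTE ne_u) mulr0.
Qed.

Definition pairing (x : free_operad Ed 3%N) (y : free_operad E 3%N) : K :=
  sgn_form (coefs (free_of_dual 3%N x)) (coefs y).

Lemma act_form_sum (s : 'S_3) (a b a' b' : E) :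
  act_form s (comp_bI (free_gen a) (free_gen b)) (comp_bI (free_gen a') (free_gen b')) =
  \sum_u \sum_v \sum_u' \sum_v'
    ((a : {ffun _}) u * (b : {ffun _}) v) *
    (((a' : {ffun _}) u' * (b' : {ffun _}) v') *
     act_form s (op_act (comb_coord u v).2 (mono K (comb_coord u v).1))
       (op_act (comb_coord u' v').2 (mono K (comb_coord u' v').1))).
Proof.
rewrite comp_bI_expand (lin_sum (act_form_linearl s _)); apply: eq_bigr => u _.
rewrite (lin_sum (act_form_linearl s _)); apply: eq_bigr => v _.
rewrite (linZ (act_form_linearl s _)) comp_bI_expand (lin_sum (act_form_linearr s _)).
rewrite scaler_sumr; apply: eq_bigr => u' _.
rewrite (lin_sum (act_form_linearr s _)) scaler_sumr.
by apply: eq_bigr => v' _; rewrite (linZ (act_form_linearr s _)).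
Qed.

Lemma pairing_dual : dual_pairing pairing.
Proof.
split.
- move=> y c x x'; rewrite /pairing (om_lin free_of_dual) (coefs_linear c).
  exact: sgn_form_linearl.
- move=> x c y y'; rewrite /pairing (coefs_linear c); exact: sgn_form_linearr.
- by move=> s x y; rewrite /pairing om_act !coefs_act sgn_form_act.
- move=> f g a b; rewrite /pairing om_comp !free_map_gen -[comp_bI _ (free_gen b)]op_act1.
  rewrite -/(act_form _ _ _) act_form_sum; under eq_bigr do under eq_bigr do under eq_bigr do
    under eq_bigr do rewrite /act_form op_act1 sgn_form_left_comb.
  have evE (h : 'Hom(E, K^o)) (x : E) :
      h x = \sum_(u : bool * 'S_2) (-1) ^+ u.2 * (of_dual h : {ffun _}) u * (x : {ffun _}) u.
    by rewrite -{1}(of_dualK h) to_dualE.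
  rewrite (evE f) (evE g) mulr_suml; apply: eq_bigr => u _.
  rewrite mulr_sumr; apply: eq_bigr => v _.
  rewrite (bigD1 u) //= [X in _ + X]big1 ?addr0 => [|u' ne_u]; last first.
    by apply: big1 => v' _; rewrite eq_sym (negbTE ne_u) !mulr0.
  rewrite (bigD1 v) //= [X in _ + X]big1 ?addr0 => [|v' ne_v]; last first.
    by rewrite [v == _]eq_sym (negbTE ne_v) andbF !mulr0.
  rewrite !eqxx mulr1.
  move: (_ u) (_ v) (_ u) (_ v) ((-1) ^+ _) ((-1) ^+ _) => x1 x2 x3 x4 x5 x6.
  by rewrite /=; ring.
- move=> f g a b s ne_s; rewrite /pairing om_comp !free_map_gen.
  rewrite -/(act_form _ _ _) act_form_sum; do 4![apply: big1 => ? _].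
  by rewrite /act_form sgn_form_left_comb0 // !mulr0.
Qed.

End SelfDuality.

(** * Orthogonality of the two systems of relations *)

Section Orthogonality.
Variable K : fieldType.
Local Notation E := (gens2 K).
Local Notation F := (free_operad E).

Let L (b c : bool) : monomial := (ord0, (b, c)).
Let R (b c : bool) : monomial := (ord_max, (b, c)).

Lemma comp_bI_mono b c :
  comp_bI (free_gen (free_basis K 2 b)) (free_gen (free_basis K 2 c)) = mono K (L b c).
Proof. by []. Qed.

Lemma comp_Ib_mono b c :
  comp_Ib (free_gen (free_basis K 2 b)) (free_gen (free_basis K 2 c)) = mono K (R b c).
Proof. by []. Qed.

(** Different translates involve different monomials, so that only s = 1 matters,
    and there two relations share either no monomial or two, with opposite
    contributions. *)
Lemma nearrow_rels_orthogonal s x y :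
  holds_rels (@nearrow_dual_rels K) x -> holds_rels (@nearrow_rels K) y ->
  act_form s x y = 0.
Proof.
rewrite /holds_rels !inE /free_m /free_u !(comp_bI_mono, comp_Ib_mono).
have subl := lin_sub (act_form_linearl s _); have subr := lin_sub (act_form_linearr s _).
move=> /or4P[|||/orP[]] /eqP-> /or3P[] /eqP->.
all: rewrite ?subr ?subl !act_form_mono /=.
all: case: (s == 1%g); rewrite ?andbF ?andbT /=.
all: rewrite ?mulr0 ?mulr1 ?subr0 ?expr0 ?expr1 ?sub0r ?opprK ?oppr0 ?subrr ?addrN ?addNr //.
Qed.

Lemma nearrow_submodule_orthogonal s x y :
  holds_rels (@nearrow_dual_rels K) x -> in_submodule (holds_rels (@nearrow_rels K)) y ->
  act_form s x y = 0.
Proof.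
move=> Rx Ry; elim: Ry s => {y} [y Ry | | c y y' _ IHy _ IHy' | t y _ IHy] s.
- exact: nearrow_rels_orthogonal.
- exact: (lin0 (act_form_linearr s x)).
- by rewrite (act_form_linearr s x) IHy IHy' scaler0 addr0.
- by rewrite act_form_act.
Qed.

Lemma big_monomial (V : nmodType) (f : monomial -> V) :
  \sum_k f k = (f (L true true) + f (L true false) + (f (L false true) + f (L false false)))
    + (f (R true true) + f (R true false) + (f (R false true) + f (R false false))).
Proof.
rewrite (eq_bigr (fun k => f (k.1, (k.2.1, k.2.2)))) => [|[i [b c]] //].
rewrite -(pair_bigA _ (fun i p => f (i, (p.1, p.2)))) /= big_ord_recl big_ord1.
do 2!rewrite -(pair_bigA _ (fun b c => f (_, (b, c)))) /= !big_bool.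
by rewrite (_ : lift _ _ = ord_max) //; apply: val_inj.
Qed.

(** The conditions on the coefficients concern one translate s at a time, so the
    element is split into its layers.  In each, the coefficients on u o_1 u,
    u o_1 m and m o_1 m are eliminated. *)
Lemma orthogonal_in_dual_ideal y :
  (forall s r, holds_rels (@nearrow_rels K) r -> act_form s y r = 0) ->
  in_ideal (holds_rels (@nearrow_dual_rels K)) y.
Proof.
move=> orth; set I := generated_ideal (holds_rels (@nearrow_dual_rels K)).
pose d k s := (coefs y : {ffun _}) (k, s).
have relE k k' s : holds_rels (@nearrow_rels K) (mono K k - mono K k') ->
    (-1) ^+ k.1 * d k s = (-1) ^+ k'.1 * d k' s.
  move=> /(orth s); rewrite (lin_sub (act_form_linearr s y)) !act_form_coefs.
  move/eqP; rewrite subr_eq0 -!mulrA ![_ * ((-1) ^+ s * _)]mulrCA.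
  by move/eqP/(can_inj (signrMK _)).
have uu s : d (R false false) s = - d (L false false) s.
  have := relE (L false false) (R false false) s.
  by rewrite expr0 expr1 mul1r mulN1r => -> //; rewrite ?opprK // /holds_rels !inE eqxx.
have mu s : d (R false true) s = - d (L true false) s.
  have := relE (R false true) (L true false) s.
  rewrite expr0 expr1 mul1r mulN1r => <-; rewrite ?opprK //.
  by rewrite /holds_rels !inE eqxx orbT.
have mm s : d (R true true) s = - d (L true true) s.
  have := relE (L true true) (R true true) s.
  rewrite expr0 expr1 mul1r mulN1r => ->; rewrite ?opprK //.
  by rewrite /holds_rels !inE eqxx !orbT.
have rel_in x : x \in (nearrow_dual_rels (free_m K) (free_u K) : seq (F 3%N)) -> I 3%N x.
  by move=> Rx; apply: InIdealGen.
have sum_in (J : finType) (x : J -> F 3%N) : (forall j, I 3%N (x j)) -> I 3%N (\sum_j x j).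
  by move=> Ix; elim/big_ind: _ => [|x1 x2|//]; [apply: sub_pred0 | apply: sub_predD].
pose layer s : F 3%N := \sum_k d k s *: mono K k.
have yE : y = \sum_s op_act s (layer s).
  pose G k s : F 3%N := d k s *: op_act s (mono K k).
  rewrite {1}(coefs_expand y) (eq_bigr (fun u => G u.1 u.2)) => [|[k s] _ //].
  rewrite -(pair_bigA _ G) exchange_big; apply: eq_bigr => s _.
  by rewrite (lin_sum (op_act_lin s)); apply: eq_bigr => k _; rewrite (linZ (op_act_lin s)).
rewrite -[in_ideal _ y]/(I 3%N y) yE; apply: sum_in => s.
apply: id_act; rewrite /layer big_monomial uu mu mm.
(* The terms with opposite coefficients are brought together. *)
rewrite !scaleNr [X in I _ X](AC ((2*2)*(2*2)) ((1*5)*((2*7)*(3*((4*8)*6))))) /=.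
rewrite -!scalerBr.
rewrite -[in_ideal _ _]/(I 3%N _).
apply: sub_predP; last (apply: sub_predP; last (apply: sub_predP;
  last (apply: sub_predP; last apply: sub_predZ))).
all: apply: rel_in; rewrite !inE eqxx ?orbT //.
Qed.

End Orthogonality.

Local Close Scope ring_scope.

Theorem theorem8 (K : fieldType) :
  exists m u : koszul_dual (nearrow_data K) 2,
    presented_by (@nearrow_dual_rels K) m u.
Proof.
pose orthog := @rels_orthogonal K (nearrow_data K).
have RS x : holds_rels (@nearrow_dual_rels K) x -> in_ideal orthog (free_to_dual K 3 x).
  move=> Rx; apply: InIdealGen; exists (@pairing K); first exact: pairing_dual.
  move=> r Rr; rewrite /pairing free_to_dualK -[r]op_act1.
  exact: (nearrow_submodule_orthogonal _ Rx Rr).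
have SR x : orthog x -> in_ideal (holds_rels (@nearrow_dual_rels K)) (free_of_dual K 3 x).
  move=> [B dualB Bx]; apply: orthogonal_in_dual_ideal => s r Rr.
  rewrite -[LHS]/(pairing x (op_act s r)) (dual_pairing_unique (@pairing_dual K) dualB).
  by apply: Bx; apply: InSubAct; apply: InSubGen.
exists (quotient_map RS 2 (operad_proj _ (free_m K))).
exists (quotient_map RS 2 (operad_proj _ (free_u K))).
exists (quotient_map RS); last by [].
apply: (quotient_map_iso RS SR) => n; [exact: free_to_dualK | exact: free_of_dualK].
Qed.
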